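(* Let $n\ge 1$ and consider the action of the symmetric group $S_n$ on the permutahedron $\Pi_n\subset\mathbb{R}^n$. The following three conditions are equivalent: (i) the toric variety $X_{\Pi_n}$ of $\Pi_n$ admits an $S_n$-invariant non-degenerate hypersurface; (ii) the equivariant $H^*$-series $H^*[z]$ of $\Pi_n$ is effective; (iii) the equivariant $H^*$-series $H^*[z]$ of $\Pi_n$ is a polynomial.
   Context: $S_n$ acts on $\mathbb{R}^n$ and $\mathbb{Z}^n$ by permuting coordinates. The permutahedron $\Pi_n$ is the convex hull of all permutations of the point $(1,2,\dots,n)$. Equivariant $H^*$-series. Let $G=S_n$ and $P=\Pi_n$. Let $M$ be the sublattice of $\mathbb{Z}^n$ obtained by translating the affine span of $P$ to the origin (i.e. $M=\{x\in\mathbb{Z}^n : \sum_i x_i=0\}$), with the induced representation $\rho:G\to GL(M)$. For $t\ge 0$ let $\chi_{tP}$ be the permutation character of $G$ acting on the lattice points $tP\cap\mathbb{Z}^n$; thus $\chi_{tP}(g)$ is the number of points of $tP\cap\mathbb{Z}^n$ fixed by $g$ (and $\chi_{0P}=1$). Let $R(G)$ be the ring of virtual characters of $G$ (integer combinations of irreducible complex characters). The series $H^*[z]=\sum_{i\ge 0}H^*_i z^i\in R(G)[[z]]$ is defined by $$\sum_{t\ge 0}\chi_{tP}(g)z^t=\frac{H^*[z](g)}{(1-z)\det(I-\rho(g)z)}\qquad\text{for all } g\in G.$$ $H^*[z]$ is effective if each $H^*_i$ is the character of a (possibly zero) representation of $G$, i.e. a non-negative integer combination of irreducible characters. $H^*[z]$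 is a polynomial if $H^*_i=0$ for all but finitely many $i$. Invariant non-degenerate hypersurfaces. For $v\in\mathbb{Z}^n$ write $x^v=x_1^{v_1}\cdots x_n^{v_n}$. A hypersurface in the projective toric variety $X_P$ is given by an equation $f=\sum_{v\in P\cap\mathbb{Z}^n}a_v x^v=0$ with complex coefficients $a_v$. It is $G$-invariant if $a_u=a_v$ whenever $u,v\in P\cap\mathbb{Z}^n$ lie in the same $G$-orbit. A hypersurface $f=0$ is smooth if the gradient $(\partial f/\partial x_1,\dots,\partial f/\partial x_n)$ is nonzero at every point of $(\mathbb{C}^* )^n$. The hypersurface $\sum_{v\in P\cap\mathbb{Z}^n}a_vx^v=0$ is non-degenerate if it is smooth and, for each nonempty face $F$ of $P$, the hypersurface $\sum_{v\in F\cap\mathbb{Z}^n}a_vx^v=0$ is also smooth. *)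

(* Defs.v *)
From HB Require Import structures.
From mathcomp Require Import all_boot all_order all_algebra all_fingroup.
From mathcomp Require Import all_field all_character.
From mathcomp Require Import finmap complex.
From mathcomp Require Import boolp classical_sets functions cardinality fsbigop.
From mathcomp Require Import reals topology normedtype derive convex.

Set Implicit Arguments.
Unset Strict Implicit.
Unset Printing Implicit Defensive.

Import Order.TTheory GRing.Theory Num.Theory.
Import numFieldNormedType.Exports.

Local Open Scope classical_set_scope.
Local Open Scope ring_scope.

(* The symmetric group acts by [col_perm], with
   [col_perm (s * t) v = col_perm s (col_perm t v)]. *)

Definition permutahedron (R : realType) (n : nat) : set 'rV[R]_n :=
  smallest (@convex_set R 'rV[R]_n)
    [set v | exists s : 'S_n, v = col_perm s (\row_(j < n) (j.+1)%:R)].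

Definition dilate (R : realType) (n : nat) (t : nat) (P : set 'rV[R]_n) :
    set 'rV[R]_n :=
  [set t%:R *: x | x in P].

Definition lattice_points (R : realType) (n : nat) (P : set 'rV[R]_n) :
    set 'rV[int]_n :=
  [set v | P (map_mx intr v)].

Definition is_face (R : realType) (n : nat) (P F : set 'rV[R]_n) : Prop :=
  exists (c : 'cV[R]_n) (b : R),
    (forall x, P x -> (x *m c) 0 0 <= b) /\
    F = [set x | P x /\ (x *m c) 0 0 = b].

(* [fset_set A] is the finite set [A] (empty if [A] is infinite, but polytopes
   are bounded). *)
Definition lattice_char (R : realType) (n t : nat) (g : 'S_n) : nat :=
  #|` fset_set [set v | lattice_points (dilate t (@permutahedron R n)) v
                        /\ col_perm g v = v] |%fset.

(* The rows e_i - e_(i+1) form a Z-basis of M = {x in Z^n | sum_i x_i = 0}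
   (of rank n - 1). *)
Definition root_basis (n : nat) : 'M[rat]_(n.-1, n) :=
  \matrix_(i, j) ((j == i :> nat)%:R - (j == i.+1 :> nat)%:R).

(* The matrix of [col_perm g] on M in this basis, for row vectors of
   coordinates; it is therefore the transpose of the usual matrix of rho(g),
   which does not affect det(I - rho(g) z). *)
Definition rho (n : nat) (g : 'S_n) : 'M[rat]_(n.-1) :=
  conjmx (root_basis n) (lin1_mx (col_perm g)).

Definition Hstar_denom (n : nat) (g : 'S_n) : {poly rat} :=
  (1 - 'X) * \det (1%:M - 'X *: map_mx polyC (rho g)).

(* H^*[z](g) = (1 - z) det(I - rho(g) z) * sum_t chi_(tP)(g) z^t, with the
   product of power series written out as a Cauchy product. *)
Definition Hstar_coef (R : realType) (n i : nat) (g : 'S_n) : rat :=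
  \sum_(j < i.+1) (Hstar_denom g)`_j * (lattice_char R (i - j) g)%:R.

Fact root_basis_inv n :
  root_basis n *m (\matrix_(k, j) (k <= j)%N%:R) = 1%:M.
Proof.
apply/matrixP => i j; rewrite !mxE.
have n0 : (0 < n)%N by case: (n) i j => [|//] [].
have hi : (i < n)%N by apply: leq_trans (ltn_ord i) (leq_pred _).
have hi1 : (i.+1 < n)%N by rewrite -[X in (_ < X)%N](prednK n0) ltnS ltn_ord.
under eq_bigr => k _ do rewrite !mxE mulrBl.
rewrite sumrB (bigD1 (Ordinal hi)) //= eqxx mul1r big1 ?addr0; last first.
  by move=> k /eqP hk; case: eqP => [e|]; rewrite ?mul0r //; case: hk; apply: val_inj.
rewrite (bigD1 (Ordinal hi1)) //= eqxx mul1r big1 ?addr0; last first.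
  by move=> k /eqP hk; case: eqP => [e|]; rewrite ?mul0r //; case: hk; apply: val_inj.
rewrite -(inj_eq val_inj) /=; case: ltngtP => _; rewrite ?subrr ?subr0 //.
Qed.

Fact root_basis_free n : row_free (root_basis n).
Proof. by apply/row_freeP; eexists; exact: root_basis_inv. Qed.

Fact root_basis_ker n : (root_basis n :=: kermx (const_mx 1 : 'cV[rat]_n))%MS.
Proof.
have sub : (root_basis n <= kermx (const_mx 1 : 'cV[rat]_n))%MS.
  apply/sub_kermxP/matrixP => i j; rewrite !mxE.
  under eq_bigr => k _ do rewrite !mxE mulr1.
  have n0 : (0 < n)%N by case: (n) i => [[]|].
  have hi : (i < n)%N by apply: leq_trans (ltn_ord i) (leq_pred _).
  have hi1 : (i.+1 < n)%N by rewrite -[X in (_ < X)%N](prednK n0) ltnS ltn_ord.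
  rewrite sumrB (bigD1 (Ordinal hi)) //= eqxx big1 ?addr0; last first.
    by move=> k /negPf hk; move: hk; rewrite -val_eqE /= => ->.
  rewrite (bigD1 (Ordinal hi1)) //= eqxx big1 ?addr0 ?subrr //.
  by move=> k /negPf hk; move: hk; rewrite -val_eqE /= => ->.
apply/eqmxP; rewrite -(geq_leqif (mxrank_leqif_eq sub)).
rewrite mxrank_ker (eqP (root_basis_free n)) -mxrank_tr rank_rV.
case: n {sub} => [|n]; first by rewrite sub0n.
rewrite -subn1 leq_sub2l // lt0b; apply/eqP => /matrixP/(_ 0 0)/eqP.
by rewrite !mxE oner_eq0.
Qed.

Fact lin1_col_perm (n : nat) (g : 'S_n) :
  lin1_mx (col_perm g) = perm_mx g^-1 :> 'M[rat]_n.
Proof.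
by apply/row_matrixP => i; rewrite !rowE mul_rV_lin1 /= col_permE.
Qed.

Fact root_basis_stable (n : nat) (g : 'S_n) :
  stablemx (root_basis n) (lin1_mx (col_perm g)).
Proof.
rewrite root_basis_ker; apply/sub_kermxP.
rewrite lin1_col_perm -mulmxA.
rewrite (_ : perm_mx _ *m const_mx 1 = const_mx 1); last first.
  by rewrite -row_permE; apply/matrixP => i j; rewrite !mxE.
by apply/sub_kermxP; rewrite root_basis_ker.
Qed.

Fact rhoM (n : nat) (g h : 'S_n) : rho (g * h)%g = rho h *m rho g.
Proof.
rewrite /rho -conjmxM ?inE ?root_basis_free ?root_basis_stable //.
by rewrite !lin1_col_perm -perm_mxM invMg.
Qed.

Fact Hstar_denomJ (n : nat) (g x : 'S_n) :
  Hstar_denom (g ^ x)%g = Hstar_denom g.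
Proof.
have rho1 : rho (1 : 'S_n)%g = 1%:M.
  rewrite /rho lin1_col_perm invg1 perm_mx1 /conjmx mulmx1.
  by rewrite mulmxVp ?root_basis_free.
have rhoVK : rho x *m rho x^-1 = 1%:M by rewrite -rhoM mulVg.
have rhoKV : rho x^-1 *m rho x = 1%:M by rewrite -rhoM mulgV.
congr (_ * _); rewrite conjgE !rhoM; move: rhoVK rhoKV.
move: (rho x) (rho x^-1) (rho g) => A B C AB BA.
rewrite (_ : 1%:M - _ =
  map_mx polyC A *m (1%:M - 'X *: map_mx polyC C) *m map_mx polyC B).
  rewrite !det_mulmx mulrAC -det_mulmx -map_mxM AB map_mx1.
  by rewrite det1 mul1r.
rewrite mulmxBr mulmxBl mulmx1 -map_mxM AB map_mx1; congr (_ - _).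
by rewrite -scalemxAr -scalemxAl !map_mxM.
Qed.

Fact permutahedron_perm (R : realType) (n : nat) (s : 'S_n) (x : 'rV[R]_n) :
  @permutahedron R n x -> @permutahedron R n (col_perm s x).
Proof.
move=> Px A [cA sA]; apply: (Px [set y | A (col_perm s y)]); split.
  move=> y z l; rewrite !inE /= => Ay Az.
  have := cA (col_perm s y) (col_perm s z) l; rewrite !inE => /(_ Ay Az).
  by congr A; apply/rowP => j; rewrite !mxE.
move=> y [t ->] /=; apply: sA; exists (s * t)%g.
by apply/rowP => j; rewrite !mxE permM.
Qed.

Fact lattice_charJ (R : realType) (n t : nat) (g x : 'S_n) :
  lattice_char R t (g ^ x)%g = lattice_char R t g.
Proof.
pose A (h : 'S_n) := [set v | lattice_points (dilate t (@permutahedron R n)) v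
                              /\ col_perm h v = v].
have cpM (s u : 'S_n) (v : 'rV[int]_n) :
  col_perm (s * u)%g v = col_perm s (col_perm u v).
  by apply/rowP => j; rewrite !mxE permM.
have cp1 (v : 'rV[int]_n) : col_perm 1%g v = v.
  by apply/rowP => j; rewrite !mxE perm1.
have sub (h y : 'S_n) v : A (h ^ y)%g v -> A h (col_perm y v).
  move=> [[p Pp pv] hv]; split.
    exists (col_perm y p); first exact: permutahedron_perm.
    rewrite -[LHS]/(_ *: _); apply/rowP => j.
    by move/rowP/(_ (y j)): pv; rewrite !mxE.
  by rewrite -[in RHS]hv -!cpM -conjgC.
have im : A g = col_perm x @` A (g ^ x)%g.
  apply/seteqP; split => [v Av|_ [v Av <-]]; last exact: sub.
  exists (col_perm x^-1 v); last by rewrite -cpM mulgV cp1.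
  by apply: sub; rewrite -conjgM mulgV conjg1.
have inj : injective (col_perm x : 'rV[int]_n -> _).
  by move=> v w /(congr1 (col_perm x^-1)); rewrite -!cpM mulVg !cp1.
rewrite /lattice_char -/(A g) -/(A (g ^ x)%g) im.
have [fin|inf] := pselect (finite_set (A (g ^ x)%g)).
  by rewrite fset_set_image // card_imfset.
rewrite /fset_set; case: pselect => // _; case: pselect => // fin'.
case: inf; apply: sub_finite_set (finite_image (col_perm x^-1) fin') => v Av.
exists (col_perm x v); first by exists v.
by rewrite -cpM mulVg cp1.
Qed.

Fact Hstar_class_fun (R : realType) (n i : nat) :
  is_class_fun <<[set: 'S_n]%G>>%g
    [ffun g : 'S_n => ratr (Hstar_coef R i g) : algC].
Proof.
rewrite genGid; apply: intro_class_fun => [g x _ _|g].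
  congr ratr; apply: eq_bigr => j _.
  by rewrite Hstar_denomJ lattice_charJ.
by rewrite inE.
Qed.

Definition Hstar (R : realType) (n i : nat) : 'CF([set: 'S_n]%G) :=
  Cfun 0 (Hstar_class_fun R n i).

Definition Hstar_effective (R : realType) (n : nat) : Prop :=
  forall i, Hstar R n i \is a character.

Definition Hstar_polynomial (R : realType) (n : nat) : Prop :=
  exists N, forall i, (N <= i)%N -> Hstar R n i = 0.

(* R[i]^o is the field R[i] of complex numbers as a normed space over itself. *)
Definition hypersurface (R : realType) (n : nat) (F : set 'rV[R]_n)
    (a : 'rV[int]_n -> R[i]^o) (x : 'rV[R[i]^o]_n) : R[i]^o :=
  \sum_(v \in lattice_points F) a v * \prod_(i < n) x 0 i ^ v 0 i.

Definition smooth (R : realType) (n : nat) (f : 'rV[R[i]^o]_n -> R[i]^o) :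
    Prop :=
  forall x : 'rV[R[i]^o]_n,
    (forall i, x 0 i != 0) -> exists i, 'D_(delta_mx 0 i) f x != 0.

Definition invariant_coefs (R : realType) (n : nat) (P : set 'rV[R]_n)
    (a : 'rV[int]_n -> R[i]^o) : Prop :=
  forall u v, lattice_points P u -> lattice_points P v ->
    (exists s : 'S_n, v = col_perm s u) -> a u = a v.

Definition nondegenerate (R : realType) (n : nat) (P : set 'rV[R]_n)
    (a : 'rV[int]_n -> R[i]^o) : Prop :=
  smooth (hypersurface P a) /\
  forall F, is_face P F -> F !=set0 -> smooth (hypersurface F a).

Definition has_invariant_nondegenerate (R : realType) (n : nat) : Prop :=
  exists a, invariant_coefs (@permutahedron R n) a /\
            nondegenerate (@permutahedron R n) a.

(* Main.v *)
Require Import Defs.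
From mathcomp Require Import all_boot reals.
From mathcomp Require Import all_order all_algebra all_fingroup all_field.
From mathcomp Require Import all_character finmap complex ring lra zify.
From mathcomp Require Import boolp classical_sets functions cardinality fsbigop.
From mathcomp Require Import interval_inference topology normedtype derive convex.

Set Implicit Arguments.
Unset Strict Implicit.
Unset Printing Implicit Defensive.

Import Order.TTheory GRing.Theory Num.Theory.
Import numFieldNormedType.Exports.

Local Open Scope classical_set_scope.
Local Open Scope ring_scope.

(** The three conditions hold for [n <= 3] and all fail for [n >= 4].

If [H*] is effective, it is a polynomial ([effective_polynomial]). Indeed the
degrees of its coefficients are natural numbers whose [n]-fold iterated sum
counts the lattice points of [t P]; there are at most [C t^(n-1)] of those, so
the sum of the degrees is bounded, almost all of them vanish, and a character
of degree [0] is [0].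

For [n >= 4], [H*] is not a polynomial ([not_polynomial]). Take a cycle [g] of
even length [k], where [n - k] is [2] or [3] according to the parity of [n].
The denominator of the series of [g] is [(1 - z)^(n-k) (1 - z^k)]
([Hstar_denom_block_cycle]), so that it vanishes to order [1] at [z = -1]. The
lattice points of [t P] fixed by [g] are counted slice by slice, according to
the common value of the coordinates moved by [g] ([lattice_char_slices],
[lattice_char2E], [lattice_char3E]). That value runs over integers, while
the extreme values are half-integers when [t] is odd, so that the counts for
even and for odd [t] are two polynomials whose difference has positive degree:
the series has a pole of order at least [2] at [-1].

For [n >= 4] there is no invariant non-degenerate hypersurface either
([no_invariant_nondegenerate]): on the face [x_1 + x_2 = 3], [x_3 + x_4 = 7],
exchanging [x_1] and [x_2], or [x_3] and [x_4], changes the sign of the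
polynomial when [x_1 + x_2 = 0], respectively [x_3 + x_4 = 0]. So it vanishes
on both hypersurfaces, and it is singular where they meet.

For [n <= 3], [H*] is computed on conjugacy classes ([effective_1],
[effective_2], [effective_3]) and the hypersurface with all coefficients [1]
is non-degenerate ([nondegenerate_1], [nondegenerate_2], [nondegenerate_3]):
the lattice points of a proper face are linearly independent, and the hexagon
for [n = 3] is treated by hand.

Membership in [t P], used in both directions throughout, is Rado's
description of the permutahedron by the sums over subsets of coordinates
([dilate_permutahedronP]). *)

(** * Majorization and the points of the dilated permutahedron *)

Lemma convex_setP (R : realType) (n : nat) (C : set 'rV[R]_n) :
  @convex_set R 'rV[R]_n C <->
  (forall x y l, C x -> C y -> 0 <= l -> l <= 1 -> C (l *: x + (1 - l) *: y)).
Proof.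
split=> [cC x y l Cx Cy l0 l1|cC x y l]; last first.
  rewrite !inE => Cx Cy; exact: (cC x y l%:num).
by have := cC x y (Itv01 l0 l1); rewrite !inE => /(_ Cx Cy).
Qed.

(** Rado's theorem by elementary transfers: if [x] differs from [y], some
coordinate of [y] is too small and a later one too large. Moving the largest
possible amount between the two keeps [y] in the convex hull of its
rearrangements (as [x] is sorted, the two coordinates of [y] are at least
twice that amount apart), keeps the partial sums dominated, and
settles one more coordinate. *)
Lemma majorization_convex (R : realType) (n : nat) (C : set 'rV[R]_n)
    (x : 'rV[R]_n) :
  @convex_set R 'rV[R]_n C ->
  (forall (s : 'S_n) v, C v -> C (col_perm s v)) ->
  (forall i j : 'I_n, (i <= j)%N -> x 0 i <= x 0 j) ->
  forall y, C y ->
  (forall m, \sum_(i < n | (i < m)%N) y 0 i <= \sum_(i < n | (i < m)%N) x 0 i) ->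
  \sum_i y 0 i = \sum_i x 0 i -> C x.
Proof.
move=> /convex_setP cC pC xs y.
have [N] := ubnP #|[set i : 'I_n | x 0 i != y 0 i]%SET|.
elim: N y => // N IH y leN Cy dom tot.
have [e|] := eqVneq x y; first by rewrite e.
rewrite -subr_eq0 => dn0; pose d := x - y.
have dE i : d 0 i = x 0 i - y 0 i by rewrite !mxE.
have Dm m : 0 <= \sum_(i < n | (i < m)%N) d 0 i.
  by under eq_bigr do rewrite dE; rewrite sumrB subr_ge0.
have D0 : \sum_i d 0 i = 0.
  by under eq_bigr do rewrite dE; rewrite sumrB tot subrr.
have [k0 k0P] : exists k, d 0 k < 0.
  apply/existsP; apply: contraNT dn0; rewrite negb_exists => /forallP H.
  apply/eqP/rowP => i; rewrite [RHS]mxE; apply/eqP.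
  have := D0; rewrite (bigD1 i) //= => /eqP; rewrite paddr_eq0.
  - by case/andP.
  - by rewrite leNgt.
  - by apply: sumr_ge0 => j _; rewrite leNgt.
case: (@arg_minnP _ k0 (fun k => d 0 k < 0) (@nat_of_ord n) k0P) => k dk kmin.
have dpos (i : 'I_n) : (i < k)%N -> 0 <= d 0 i.
  by move=> ik; rewrite leNgt; apply/negP => /kmin; rewrite leqNgt ik.
have [j /andP[jk dj]] : exists j : 'I_n, (j < k)%N && (0 < d 0 j).
  apply/existsP; have := Dm k.+1; apply: contraTT.
  rewrite negb_exists => /forallP H; rewrite -ltNge (bigD1 k) //=.
  rewrite big1 ?addr0 // => i /andP[ik ni].
  have ltik : (i < k)%N by rewrite ltn_neqAle ni.
  by apply: le_anti; rewrite dpos // andbT leNgt; move: (H i); rewrite ltik.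
have njk : j != k by apply: contraTneq jk => ->; rewrite ltnn.
pose e := Num.min (d 0 j) (- d 0 k).
have e0 : 0 < e by rewrite lt_min dj oppr_gt0.
have ej : e <= d 0 j by rewrite ge_min lexx.
have ek : e <= - d 0 k by rewrite ge_min lexx orbT.
have xjk := xs j k (ltnW jk).
have gap : 2 * e <= y 0 k - y 0 j by move: ej ek; rewrite !dE; lra.
have gap0 : 0 < y 0 k - y 0 j by lra.
pose y' : 'rV[R]_n := y + e *: (delta_mx 0 j - delta_mx 0 k).
have y'E i : y' 0 i = y 0 i + e * ((i == j)%:R - (i == k)%:R).
  by rewrite !mxE eqxx.
have Cy' : C y'.
  pose l := 1 - e / (y 0 k - y 0 j).
  have l1 : l <= 1 by rewrite /l gerBl divr_ge0 // ltW.
  have l0 : 0 <= l.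
    by rewrite /l subr_ge0 ler_pdivrMr // mul1r; lra.
  have := cC y (col_perm (tperm j k) y) l Cy (pC _ _ Cy) l0 l1.
  congr C; apply/rowP => i; rewrite y'E !mxE /l subKr.
  have el : e = e / (y 0 k - y 0 j) * (y 0 k - y 0 j) by rewrite divfK // gt_eqF.
  case: tpermP => [->|->|/eqP/negPf ij /eqP/negPf ik].
  - by rewrite eqxx (negPf njk) [in RHS]el /=; ring.
  - by rewrite eqxx eq_sym (negPf njk) [in RHS]el /=; ring.
  - by rewrite ij ik /=; ring.
have sumb (P : pred 'I_n) i : \sum_(l | P l) (l == i)%:R = (P i)%:R :> R.
  rewrite big_mkcond (bigD1 i) //= eqxx big1 ?addr0; first by case: (P i).
  by move=> l /negPf ->; case: ifP.
have sumd (P : pred 'I_n) : \sum_(i | P i) y' 0 i =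
    \sum_(i | P i) y 0 i + e * ((P j)%:R - (P k)%:R).
  under eq_bigr do rewrite y'E.
  by rewrite big_split /= -mulr_sumr sumrB !sumb.
apply: (IH y') => //.
- rewrite -ltnS; apply: leq_trans leN; rewrite ltnS.
  apply: proper_card; rewrite properE; apply/andP; split.
    apply/fintype.subsetP => i; rewrite !inE y'E.
    have [->|ij] := eqVneq i j; first by move=> _; rewrite -subr_eq0 -dE gt_eqF.
    have [->|ik] := eqVneq i k; first by move=> _; rewrite -subr_eq0 -dE lt_eqF.
    by rewrite subrr mulr0 addr0.
  apply/subsetPn.
  have [de|de] : (e = d 0 j \/ e = - d 0 k) by rewrite /e; case: leP; auto.
    exists j; rewrite !inE; first by rewrite -subr_eq0 -dE gt_eqF.
    by rewrite y'E eqxx (negPf njk) de dE negbK /=; apply/eqP; ring.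
  exists k; rewrite !inE; first by rewrite -subr_eq0 -dE lt_eqF.
  by rewrite y'E eqxx [k == j]eq_sym (negPf njk) de dE negbK /=; apply/eqP; ring.
- move=> m; rewrite sumd -subr_ge0.
  have -> : forall a b c : R, a - (b + c) = a - b - c by move=> *; ring.
  rewrite subr_ge0 -sumrB; under eq_bigr do rewrite -dE.
  have [km|km] := ltnP k m.
    by rewrite (ltn_trans jk km) subrr mulr0.
  have [jm|jm] := ltnP j m; last by rewrite subrr mulr0.
  rewrite subr0 mulr1 (bigD1 j) //=; apply: (le_trans ej).
  rewrite lerDl sumr_ge0 // => i /andP[im _]; apply: dpos.
  exact: leq_trans im km.
- by rewrite sumd /= subrr mulr0 addr0.
Qed.

Lemma sum_set_ge (n : nat) (T : {set 'I_n}) :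
  (#|T| * #|T|.+1 <= 2 * \sum_(i in T) i.+1)%N.
Proof.
have [c] := ubnP #|T|; elim: c T => // c IH T leT.
have [->|[i0 iT0]] := set_0Vmem T; first by rewrite cards0.
(* induction by removing the largest element, which is at least [#|T| - 1] *)
case: (@arg_maxnP _ i0 (fun i => i \in T) (@nat_of_ord n) iT0) => m mT mmax.
have sub y : y \in [seq nat_of_ord i | i <- enum T] -> y \in iota 0 m.+1.
  by move=> /mapP [i iT ->]; move: iT; rewrite mem_enum => iT; rewrite mem_iota ltnS; apply: mmax.
have leTm : (#|T| <= m.+1)%N.
  rewrite cardE -(size_map (@nat_of_ord n)) -(size_iota 0 m.+1).
  by apply: uniq_leq_size => //; rewrite (map_inj_uniq (@ord_inj n)) enum_uniq.
rewrite (bigD1 m) //= mulnDr.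
have := IH (T :\ m); rewrite (cardsD1 m T) mT in leT leTm *.
rewrite add1n in leT leTm * => /(_ leT).
under [X in (_ <= 2 * X)%N -> _]eq_bigl do rewrite in_setD1 andbC.
by move: #|_| leTm (\sum_(i in T | _) _)%N; clear => a leTm b; nia.
Qed.

Lemma permutahedron_convex (R : realType) (n : nat) :
  @convex_set R 'rV[R]_n (@permutahedron R n).
Proof.
move=> x y l; rewrite !inE => Px Py C [cC sC].
by have := cC x y l; rewrite !inE; apply; [apply: Px|apply: Py].
Qed.

Lemma permutahedron_sub (R : realType) (n : nat) (C : set 'rV[R]_n) :
  (forall x y l, C x -> C y -> 0 <= l -> l <= 1 -> C (l *: x + (1 - l) *: y)) ->
  (forall s : 'S_n, C (\row_j (s j).+1%:R)) ->
  @permutahedron R n `<=` C.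
Proof.
move=> /convex_setP cC sC; apply: smallest_sub => // _ [s ->].
by have := sC s; congr C; apply/rowP => j; rewrite !mxE.
Qed.

Lemma permutahedron_vertex (R : realType) (n : nat) (s : 'S_n) :
  @permutahedron R n (\row_j (s j).+1%:R).
Proof.
apply: sub_gen_smallest; exists s.
by apply/rowP => j; rewrite !mxE.
Qed.

Lemma permutahedron_ge (R : realType) (n : nat) (x : 'rV[R]_n) (S : {set 'I_n}) :
  @permutahedron R n x -> (#|S| * #|S|.+1)%:R <= 2 * \sum_(i in S) x 0 i.
Proof.
move: x; apply: permutahedron_sub => [x y l Cx Cy l0 l1|s].
  rewrite (eq_bigr (fun i => l * x 0 i + (1 - l) * y 0 i)).
    by rewrite big_split /= -!mulr_sumr; nra.
  by move=> i _; rewrite !mxE.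
have := sum_set_ge (s @: S); rewrite card_imset; last exact: perm_inj.
rewrite big_imset /=; last by move=> i j _ _; apply: perm_inj.
rewrite -(ler_nat R) [X in _ <= X]natrM natr_sum => /le_trans; apply.
by under [X in _ <= 2 * X]eq_bigr do rewrite mxE.
Qed.

Lemma permutahedron_sum (R : realType) (n : nat) (x : 'rV[R]_n) :
  @permutahedron R n x -> 2 * \sum_i x 0 i = (n * n.+1)%:R.
Proof.
move: x; apply: permutahedron_sub => [x y l Cx Cy l0 l1|s].
  rewrite (eq_bigr (fun i => l * x 0 i + (1 - l) * y 0 i)).
    rewrite big_split /= -!mulr_sumr mulrDr !(mulrCA 2) Cx Cy; ring.
  by move=> i _; rewrite !mxE.
under eq_bigr do rewrite mxE.
rewrite -[LHS]/(2 * \sum_i (s i).+1%:R).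
have -> : \sum_i (s i).+1%:R = \sum_(i < n) i.+1%:R :> R.
  by rewrite [RHS](reindex_perm s).
rewrite -natr_sum -natrM; congr (_%:R).
elim: n {s} => [|n IH]; first by rewrite big_ord0.
by rewrite big_ord_recr /= mulnDr IH; lia.
Qed.

Lemma sorted_rearrangement (R : realDomainType) (n : nat) (x : 'rV[R]_n) :
  exists s : 'S_n, forall i j : 'I_n, (i <= j)%N ->
    col_perm s x 0 i <= col_perm s x 0 j.
Proof.
pose t := [tuple x 0 i | i < n].
have /tuple_permP [s sE] : perm_eq (sort <=%R t) t by rewrite perm_sort.
exists s => i j ij; rewrite !mxE.
have nE (k : 'I_n) : x 0 (s k) = nth 0 (sort <=%R t) k.
  by rewrite sE -tnth_nth !tnth_mktuple.
rewrite !nE; apply: (sorted_leq_nth le_trans lexx) => //.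
- by apply: sort_sorted; exact: le_total.
- by rewrite inE size_sort size_tuple.
- by rewrite inE size_sort size_tuple.
Qed.

Lemma sum_initial (n m : nat) (c := #|[set i : 'I_n | (i < m)%N]%SET|) :
  (2 * \sum_(i < n | i < m) i.+1 = c * c.+1)%N.
Proof.
have -> : c = minn m n.
  rewrite /c -sum1_card (eq_bigl (fun i : 'I_n => i < m)%N); last first.
    by move=> i; rewrite inE.
  rewrite big_mkcond; elim: n {c} => [|n IH]; first by rewrite big_ord0 minn0.
  by rewrite big_ord_recr /= IH; case: ltnP; lia.
rewrite big_mkcond; elim: n {c} => [|n IH]; first by rewrite big_ord0 minn0.
rewrite big_ord_recr /= mulnDr IH; case: ltnP => mn; last first.
  by rewrite muln0 addn0; have -> : minn m n.+1 = m by lia.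
have -> : minn m n.+1 = n.+1 by lia.
by lia.
Qed.

(** After sorting [x], the inequalities for the initial segments say that the
partial sums of [t (1, ..., n)] are dominated by those of [x]. *)
Lemma dilate_permutahedronP (R : realType) (n t : nat) (x : 'rV[R]_n) :
  dilate t (@permutahedron R n) x <->
  2 * \sum_i x 0 i = (t * (n * n.+1))%:R /\
  forall S : {set 'I_n}, (t * (#|S| * #|S|.+1))%:R <= 2 * \sum_(i in S) x 0 i.
Proof.
split=> [[y Py <-]|[tot dom]].
  have sumE (P : pred 'I_n) : \sum_(i | P i) (t%:R *: y) 0 i = t%:R * \sum_(i | P i) y 0 i.
    by rewrite mulr_sumr; apply: eq_bigr => i _; rewrite mxE.
  split=> [|S]; rewrite sumE mulrCA natrM.
    by rewrite (permutahedron_sum Py).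
  by rewrite ler_wpM2l // permutahedron_ge.
have invC (s : 'S_n) v : dilate t (@permutahedron R n) v ->
    dilate t (@permutahedron R n) (col_perm s v).
  move=> [y Py <-]; exists (col_perm s y); first exact: permutahedron_perm.
  by rewrite -[LHS]/(_ *: _); apply/rowP => j; rewrite !mxE.
have convC : @convex_set R 'rV[R]_n (dilate t (@permutahedron R n)).
  apply/convex_setP => _ _ l [p Pp <-] [q Pq <-] l0 l1.
  exists (l *: p + (1 - l) *: q).
    have /convex_setP cP := @permutahedron_convex R n; exact: cP.
  by rewrite -[LHS]/(_ *: _); apply/rowP => j; rewrite !mxE; ring.
have [s xs] := sorted_rearrangement x.
have xE : x = col_perm s^-1 (col_perm s x).
  by apply/rowP => i; rewrite !mxE permKV.
rewrite xE; apply: (invC _).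
have sumE (P : pred 'I_n) : \sum_(i | P i) col_perm s x 0 i =
   \sum_(i in s @: [set i | P i]%SET) x 0 i.
  rewrite big_imset /=; last by move=> i j _ _; apply: perm_inj.
  by apply: eq_big => i; rewrite ?inE // mxE.
have yP (P : pred 'I_n) : \sum_(j | P j) (t%:R *: \row_j (j.+1)%:R : 'rV[R]_n) 0 j =
   t%:R * (\sum_(j | P j) j.+1)%:R.
  rewrite natr_sum mulr_sumr; apply: eq_bigr => i _; by rewrite !mxE.
apply: (@majorization_convex R n _ _ convC invC xs (t%:R *: \row_j (j.+1)%:R)).
- exists (\row_j (j.+1)%:R) => //.
  have := @permutahedron_vertex R n 1%g; congr permutahedron.
  by apply/rowP => j; rewrite !mxE perm1.
- move=> m; rewrite yP sumE -(ler_pM2l (ltr0n R 2)) mulrCA -natrM.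
  by apply: le_trans (dom _); rewrite card_imset ?sum_initial ?natrM //; exact: perm_inj.
- rewrite yP -[RHS](@mulfK _ 2) // [_ * 2]mulrC.
  have -> : \sum_i col_perm s x 0 i = \sum_i x 0 i.
    by rewrite [RHS](reindex_perm s); apply: eq_bigr => i _; rewrite mxE.
  have /= := sum_initial n n; under eq_bigl do rewrite ltn_ord.
  rewrite (_ : [set i : 'I_n | (i < n)%N]%SET = [set: 'I_n]%SET); last first.
    by apply/setP => i; rewrite !inE ltn_ord.
  rewrite cardsT card_ord => e; rewrite tot -e !natrM [_ / _]mulrC.
  by rewrite mulrCA mulKf.
Qed.

Lemma lattice_dilateP (R : realType) (n t : nat) (v : 'rV[int]_n) :
  lattice_points (dilate t (@permutahedron R n)) v <->
  2 * \sum_i v 0 i = (t * (n * n.+1))%:Z /\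
  forall S : {set 'I_n}, (t * (#|S| * #|S|.+1))%:Z <= 2 * \sum_(i in S) v 0 i.
Proof.
rewrite /lattice_points /= dilate_permutahedronP.
have sumE (P : pred 'I_n) : 2 * \sum_(i | P i) (map_mx intr v : 'rV[R]_n) 0 i =
    (2 * \sum_(i | P i) v 0 i)%:~R.
  by rewrite intrM rmorph_sum /=; congr (_ * _); apply: eq_bigr => i _; rewrite mxE.
split=> [[e d]|[e d]]; split=> [|S].
- by apply/eqP; rewrite -(eqr_int R) -sumE e.
- by rewrite -(ler_int R) -sumE; apply: d.
- by rewrite sumE e.
- by have := d S; rewrite -(ler_int R) -sumE.
Qed.

(** * The denominator of the equivariant series of a cycle *)

(** The permutation representation on coordinates is the sum of [rho] and the
trivial representation: the first coordinate vector [e] together with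
the basis [B] of the sum-zero lattice makes the permutation matrix block
triangular, with diagonal blocks [1] and [rho g]. *)
Lemma Hstar_denomE (n : nat) (g : 'S_n.+1) :
  Hstar_denom g = \det (1%:M - 'X *: map_mx polyC (perm_mx g)).
Proof.
pose P : 'M[rat]_n.+1 := perm_mx g^-1.
have -> : \det (1%:M - 'X *: map_mx polyC (perm_mx g)) =
    \det (1%:M - 'X *: map_mx polyC P).
  rewrite -det_tr; congr (\det _).
  by rewrite linearB linearZ /= trmx1 map_trmx tr_perm_mx.
pose B : 'M[rat]_(n, n.+1) := root_basis n.+1.
pose e : 'rV[rat]_n.+1 := delta_mx 0 0.
pose u : 'cV[rat]_n.+1 := const_mx 1.
have Bfree : row_free B by exact: (root_basis_free n.+1).
have Bu : B *m u = 0 by apply/sub_kermxP; rewrite (root_basis_ker n.+1).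
have eu : e *m u = 1%:M.
  by rewrite -rowE; apply/matrixP => i j; rewrite !mxE !ord1.
have Pu : P *m u = u.
  by rewrite /P -row_permE; apply/matrixP => i j; rewrite !mxE.
have /submxP [w wE] : (e *m P - e <= B)%MS.
  rewrite (root_basis_ker n.+1); apply/sub_kermxP.
  by rewrite mulmxBl -mulmxA -/u Pu subrr.
have rhoE : B *m P = rho g *m B.
  by rewrite /rho lin1_col_perm -/P -/B /conjmx mulmxKpV // /P -lin1_col_perm (root_basis_stable (n:=n.+1)).
pose Bf : 'M[rat]_(1 + n, n.+1) := col_mx e B.
have Bf_free : row_free Bf.
  apply: inj_row_free => v.
  rewrite -(hsubmxK v) mul_row_col => /[dup] vB0.
  move/(congr1 (mulmx^~ u)); rewrite mulmxDl -!mulmxA eu Bu mulmx1 mulmx0 addr0.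
  rewrite mul0mx => v0; move: vB0; rewrite v0 mul0mx add0r => vB0.
  have -> : rsubmx v = 0 by apply: (row_free_inj Bfree); rewrite mul0mx.
  by rewrite row_mx0.
pose Q : 'M[rat]_(1 + n) := block_mx 1%:M w 0 (rho g).
have BfP : Bf *m P = Q *m Bf.
  rewrite mul_col_mx mul_block_col mul1mx mul0mx add0r rhoE; congr col_mx.
  by rewrite -wE addrC subrK.
pose BX := map_mx polyC Bf.
have dB : \det BX != 0.
  rewrite det_map_mx polyC_eq0 -unitfE.
  by rewrite row_free_unit in Bf_free.
apply: (mulIf dB); rewrite [RHS]mulrC -det_mulmx.
have -> : BX *m (1%:M - 'X *: map_mx polyC P) = (1%:M - 'X *: map_mx polyC Q) *m BX.
  rewrite mulmxBr mulmxBl mulmx1 mul1mx; congr (_ - _).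
  by rewrite -scalemxAr -scalemxAl -!map_mxM BfP.
rewrite det_mulmx; congr (_ * _).
have -> : 1%:M - 'X *: map_mx polyC Q =
    block_mx (1 - 'X)%:M (- ('X *: map_mx polyC w)) 0 (1%:M - 'X *: map_mx polyC (rho g)).
  rewrite /Q map_block_mx scale_block_mx [1%:M](scalar_mx_block 1 n) opp_block_mx add_block_mx.
  by rewrite map_mx1 map_mx0 scaler0 subrr add0r scale_scalar_mx mulr1 raddfB.
by rewrite det_ublock det_scalar1.
Qed.

(** In the expansion along the first column, two terms remain; one minor is upper
triangular and the other one is lower triangular. *)
Lemma det_cycle (n : nat) (x y : {poly rat}) :
  \det (\matrix_(i < n.+1, j < n.+1)
    ((i == j)%:R - x * (i.+1 == j :> nat)%:R - y * ((i == n :> nat) && (j == 0))%:R))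
  = 1 - y * x ^+ n.
Proof.
rewrite (expand_det_col _ ord0).
case: n => [|n].
  by rewrite big_ord1 !mxE /= /cofactor det_mx00 /= !mulr1 mulr0 subr0.
rewrite big_ord_recl big_ord_recr /= big1 ?add0r; last first.
  move=> i _; rewrite !mxE /= /bump add1n eqSS ltn_eqF ?ltn_ord //=.
  by rewrite !mulr0 !subr0 mul0r.
rewrite /cofactor.
set M0 := row' ord0 _; set M1 := row' (lift ord0 ord_max) _.
have dM0 : \det M0 = 1.
  rewrite -det_tr det_trig; last first.
    apply/is_trig_mxP => i j ij; rewrite !mxE /= /bump !add1n !eqSS andbF mulr0 subr0.
    rewrite -val_eqE /= /bump !add1n eqSS gtn_eqF //.
    by rewrite gtn_eqF ?mulr0 ?subr0 // ltnS ltnW.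
  rewrite big1 // => i _; rewrite !mxE eqxx /= /bump !add1n andbF mulr0 subr0.
  by rewrite gtn_eqF ?mulr0 ?subr0.
have dM1 : \det M1 = (- x) ^+ n.+1.
  rewrite det_trig; last first.
    apply/is_trig_mxP => i j ij; rewrite !mxE /= /bump !add1n !eqSS andbF mulr0 subr0.
    rewrite -val_eqE /= /bump !add1n leqNgt ltn_ord add0n.
    have [-> ->] : (i == j.+1 :> nat) = false /\ (i == j :> nat) = false by lia.
    by rewrite mulr0 subr0.
  under eq_bigr => i _.
    rewrite !mxE /= /bump !add1n andbF mulr0 subr0 leqNgt ltn_ord add0n eqxx.
    rewrite -val_eqE /= /bump !add1n leqNgt ltn_ord add0n ltn_eqF // sub0r mulr1.
    over.
  by rewrite prodr_const card_ord.
rewrite dM0 dM1 !mxE /= /bump /= !addn0 !add1n eqxx /=.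
rewrite !mulr0 !mulr1 subr0 sub0r.

by rewrite subr0 oppr0 sub0r -exprMn mulN1r opprK mulNr.
Qed.

Definition block_cycle_fun (k m : nat) (i : 'I_(k + m)) : 'I_(k + m) :=
  match fintype.split i with
  | inl a => lshift m (ordS a)
  | inr b => rshift k b
  end.

Fact block_cycle_inj (k m : nat) : injective (@block_cycle_fun k m).
Proof.
move=> i j; rewrite /block_cycle_fun; case: (split_ordP i) => a ->; case: (split_ordP j) => b ->.
- by move/lshift_inj/(bij_inj (@ordS_bij k)) => ->.
- by move/eqP; rewrite eq_lrshift.
- by move/eqP; rewrite eq_rlshift.
- by move/rshift_inj => ->.
Qed.

Definition block_cycle (k m : nat) : 'S_(k + m) := perm (@block_cycle_inj k m).

Lemma block_cycle_l (k m : nat) (i : 'I_k) :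
  block_cycle k m (lshift m i) = lshift m (ordS i).
Proof. by rewrite permE /block_cycle_fun (unsplitK (inl i)). Qed.

Lemma block_cycle_r (k m : nat) (i : 'I_m) :
  block_cycle k m (rshift k i) = rshift k i.
Proof. by rewrite permE /block_cycle_fun (unsplitK (inr i)). Qed.

Lemma Hstar_denom_block_cycle (k m : nat) :
  Hstar_denom (block_cycle k.+1 m) = (1 - 'X) ^+ m * (1 - 'X^(k.+1)).
Proof.
rewrite (Hstar_denomE (n := k + m)).
pose C : 'M[{poly rat}]_k.+1 := \matrix_(i, j)
  ((i == j)%:R - 'X * (i.+1 == j :> nat)%:R - 'X * ((i == k :> nat) && (j == 0))%:R).
suff e : 1%:M - 'X *: map_mx polyC (perm_mx (block_cycle k.+1 m)) =
    block_mx C 0 0 (1 - 'X)%:M :> 'M_(k.+1 + m).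
  transitivity (\det (block_mx C 0 0 (1 - 'X)%:M : 'M_(k.+1 + m))).
    by rewrite -e.
  by rewrite det_ublock det_cycle det_scalar mulrC exprS.
apply/matrixP => i j; rewrite !mxE.
case: (@split_ordP k.+1 m i) => a ->; rewrite ?block_cycle_l ?block_cycle_r;
  case: (@split_ordP k.+1 m j) => b ->; rewrite !(eq_lshift, eq_rshift, eq_lrshift, eq_rlshift);
  rewrite ?(row_mxEl, row_mxEr) !mxE ?polyC0 ?mulr0 ?subr0 //; last first.
  by case: eqP => _; rewrite ?polyC1 ?polyC0 ?mulr0 ?mulr1 ?subr0.
rewrite -addrA -opprD -mulrDr -natrD polyC_natr -!val_eqE /=; congr (_ - _ * _%:R).
have [->|ak] := eqVneq (a : nat) k.
  by rewrite modnn (gtn_eqF (ltn_ord b)) eq_sym.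
rewrite modn_small; first by rewrite addn0.
by rewrite ltnS ltn_neqAle ak -ltnS ltn_ord.
Qed.

(** * Effective series are polynomials *)

Definition lag_diff (k : nat) (u : nat -> rat) (i : nat) : rat :=
  u i - (if (k <= i)%N then u (i - k)%N else 0).

Definition cauchy_prod (p : {poly rat}) (u : nat -> rat) (i : nat) : rat :=
  \sum_(j < i.+1) p`_j * u (i - j)%N.

Lemma cauchy_prod1 (u : nat -> rat) : cauchy_prod 1 u =1 u.
Proof.
move=> i; rewrite /cauchy_prod big_ord_recl coef1 mul1r subn0 big1 ?addr0 //.
by move=> j _; rewrite coef1 mul0r.
Qed.

(** Multiplying a generating series by [1 - z^k] takes differences with lag [k]. *)
Lemma cauchy_prod_lag (k : nat) (p : {poly rat}) (u : nat -> rat) :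
  cauchy_prod ((1 - 'X^k) * p) u =1 lag_diff k (cauchy_prod p u).
Proof.
move=> i; rewrite /cauchy_prod /lag_diff.
under eq_bigr => j _ do rewrite mulrBl mul1r coefB coefXnM mulrBl.
rewrite sumrB; congr (_ - _).
case: leqP => ki; last first.
  by rewrite big1 // => j _; rewrite (leq_trans (ltn_ord j)) ?mul0r.
have -> : i.+1 = (k + (i - k).+1)%N by lia.
rewrite big_split_ord /= big1 ?add0r => [|j _]; last by rewrite ltn_ord mul0r.
apply: eq_bigr => j _; rewrite ltnNge leq_addr /= addKn.
by congr (_ * u _); lia.
Qed.

Lemma lag_diff_ext (k : nat) (u v : nat -> rat) :
  u =1 v -> lag_diff k u =1 lag_diff k v.
Proof. by move=> uv i; rewrite /lag_diff !uv. Qed.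

Lemma Hstar_coef_block_cycle (R : realType) (k m : nat) (i : nat) :
  Hstar_coef R i (block_cycle k.+1 m) =
  iter m (lag_diff 1) (lag_diff k.+1
    (fun t => (lattice_char R t (block_cycle k.+1 m))%:R)) i.
Proof.
rewrite /Hstar_coef Hstar_denom_block_cycle.
pose u t : rat := (lattice_char R t (block_cycle k.+1 m))%:R.
rewrite -[LHS]/(cauchy_prod _ u i) -/u.
clearbody u; elim: m i => [|l IH] i /=.
  by rewrite expr0 mul1r -[1 - _]mulr1 cauchy_prod_lag; apply/lag_diff_ext/cauchy_prod1.
rewrite exprS -mulrA -['X]expr1 cauchy_prod_lag expr1.
exact: lag_diff_ext.
Qed.

Lemma HstarE (R : realType) (n i : nat) (g : 'S_n) :
  Hstar R n i g = ratr (Hstar_coef R i g).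
Proof. by rewrite cfunE. Qed.

Definition partial_sum (u : nat -> rat) (i : nat) : rat := \sum_(j < i.+1) u j.

Lemma partial_sum_lag (u : nat -> rat) : partial_sum (lag_diff 1 u) =1 u.
Proof.
elim=> [|i IH]; first by rewrite /partial_sum big_ord1 /lag_diff /= subr0.
rewrite /partial_sum big_ord_recr /= -/(partial_sum _ i) IH /lag_diff /= subn1 /=.
by rewrite addrC subrK.
Qed.

Lemma partial_sum_ext (u v : nat -> rat) :
  u =1 v -> partial_sum u =1 partial_sum v.
Proof. by move=> uv i; apply: eq_bigr => j _. Qed.

Lemma iter_partial_sum_lag (m : nat) (u : nat -> rat) :
  iter m partial_sum (iter m (lag_diff 1) u) =1 u.
Proof.
elim: m u => // m IH u i; rewrite iterS iterSr.
by rewrite (partial_sum_ext (IH _)) partial_sum_lag.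
Qed.

Lemma iter_partial_sum_ge0 (m : nat) (u : nat -> rat) (i : nat) :
  (forall i, 0 <= u i) -> 0 <= iter m partial_sum u i.
Proof. by move=> u0; elim: m i => // m IH i; apply: sumr_ge0 => j _; apply: IH. Qed.

Lemma partial_sum_mono (u : nat -> rat) (i j : nat) :
  (forall i, 0 <= u i) -> (i <= j)%N -> partial_sum u i <= partial_sum u j.
Proof.
move=> u0 /subnK <-; elim: (j - i)%N => // l; move=> /le_trans; apply.
by rewrite addSn /partial_sum [X in _ <= X]big_ord_recr /= lerDl.
Qed.

(** Each summation raises the order of growth of a nonnegative sequence by at
least one: half of the terms of the sum up to [2 t] are at least the term
of index [t] of the nondecreasing sequence being summed. *)
Lemma partial_sum_bounded (d : nat) (u : nat -> rat) (C : rat) :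
  (forall i, 0 <= u i) ->
  (forall t, iter d.+1 partial_sum u t <= C * t.+1%:R ^+ d) ->
  exists B, forall t, partial_sum u t <= B.
Proof.
move=> u0; elim: d C => [|d IH] C bnd.
  by exists C => t; have := bnd t; rewrite expr0 mulr1.
pose w := iter d.+1 partial_sum u.
have w_mono i j : (i <= j)%N -> w i <= w j.
  by apply: partial_sum_mono => l; apply: iter_partial_sum_ge0.
have w0 i : 0 <= w i by exact: iter_partial_sum_ge0.
apply: (IH (C * 2 ^+ d.+1)) => t; rewrite -/w.
have C0 : 0 <= C.
  have := bnd 0%N; rewrite expr1n mulr1; apply: le_trans.
  exact: iter_partial_sum_ge0.
rewrite -(ler_pM2r (ltr0Sn rat t)) -[leRHS]mulrA -exprSr.
apply: (@le_trans _ _ (partial_sum w (t + t))).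
  rewrite /partial_sum -addnS big_split_ord /= -[leLHS]add0r.
  apply: lerD; first exact: sumr_ge0.
  rewrite mulr_natr -[X in _ *+ X]card_ord -sumr_const.
  by apply: ler_sum => i _; apply: w_mono; apply: leq_addr.
apply: le_trans (bnd _) _; rewrite -mulrA -exprMn ler_wpM2l //.
rewrite lerXn2r ?nnegrE ?ler0n ?mulr_ge0 // -natrM ler_nat; lia.
Qed.

Lemma eventually_zero (u : nat -> nat) (B M : nat) :
  (forall t, \sum_(M <= j < t) u j <= B)%N ->
  exists N, forall i, (N <= i)%N -> u i = 0%N.
Proof.
elim: B M => [|B IH] M bnd.
  exists M => i Mi; have := bnd i.+1.
  by rewrite big_nat_recr //= leqn0 addn_eq0 => /andP[_ /eqP].
have [[i [Mi ui]]|no] := pselect (exists i, (M <= i)%N /\ (0 < u i)%N); last first.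
  exists M => i Mi; apply/eqP; rewrite -leqn0 leqNgt; apply/negP => ui.
  by apply: no; exists i.
apply: (IH i.+1) => t; have [it|ti] := ltnP i t; last first.
  by rewrite big_geq // leqW.
have := bnd t; rewrite (big_cat_nat (n := i.+1)) //=; last exact: leqW.
rewrite (big_nat_recr i) //=.
by move: (\sum_(M <= j < i) u j)%N (\sum_(i.+1 <= j < t) u j)%N => a b; lia.
Qed.

Lemma block_cycle1 (m : nat) : block_cycle 1 m = 1%g.
Proof.
apply/permP => i; rewrite perm1; case: (@split_ordP 1 m i) => a ->.
  by rewrite block_cycle_l [a]ord1; congr lshift; apply/val_inj.
by rewrite block_cycle_r.
Qed.

Lemma lattice_coord_bound (R : realType) (n t : nat) (v : 'rV[int]_n) (i : 'I_n) :
  lattice_points (dilate t (@permutahedron R n)) v -> t%:Z <= v 0 i <= (n * t)%:Z.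
Proof.
move=> /lattice_dilateP [tot dom].
have := dom [set i]%SET; rewrite big_set1 cards1.
have := dom [set~ i]%SET; rewrite cardsC1 card_ord.
move: tot; rewrite (bigD1 i) //= mulrDr.
under [X in _ + 2 * X = _ -> _]eq_bigl => j do rewrite -in_setC1.
move: (\sum_(j in _) _) => s.
have e : (t * (n * n.+1) = t * (n.-1 * n.-1.+1) + 2 * (n * t))%N.
  by clear -i; case: n i => [[]|n _] //=; ring.
by rewrite e; lia.
Qed.

(** The sum of the coordinates is fixed, so that all coordinates but one determine
a lattice point. *)
Lemma lattice_char_bound (R : realType) (n t : nat) (g : 'S_n.+1) :
  (lattice_char R t g <= (n.+1 * t).+1 ^ n)%N.
Proof.
rewrite /lattice_char; set A := [set v | _].
have [fA|nfA] := pselect (finite_set A); last first.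
  by rewrite /fset_set; case: pselect.
pose f (v : 'rV[int]_n.+1) : {ffun 'I_n -> 'I_(n.+1 * t).+1} :=
  [ffun i => inord (absz (v 0 (lift ord0 i)))].
have Abound (v : 'rV[int]_n.+1) (i : 'I_n.+1) : A v -> 0 <= v 0 i <= (n.+1 * t)%:Z.
  by move=> [/lattice_coord_bound -/(_ i)]; lia.
have f_inj : {in fset_set A &, injective f}.
  move=> v w; rewrite !in_fset_set // !inE => Av Aw fvw.
  have vw i : v 0 (lift ord0 i) = w 0 (lift ord0 i).
    move/ffunP/(_ i)/(congr1 val): fvw; rewrite !ffunE /=.
    have := Abound v (lift ord0 i) Av; have := Abound w (lift ord0 i) Aw.
    by move=> bw bv; rewrite !inordK; lia.
  case: Av => /lattice_dilateP [tv _] _; case: Aw => /lattice_dilateP [tw _] _.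
  move: tv; rewrite -tw !big_ord_recl (eq_bigr _ (fun i _ => vw i)) => tv.
  apply/rowP => i; case: (unliftP ord0 i) => [j ->|->]; first exact: vw.
  by have /addIr := mulfI (isT : (2 : int) != 0) tv.
have -> : ((n.+1 * t).+1 ^ n)%N = #|{: {ffun 'I_n -> 'I_(n.+1 * t).+1}}|.
  by rewrite card_ffun !card_ord.
rewrite -(size_map f) -(card_uniqP _) ?max_card //.
by rewrite map_inj_in_uniq ?fset_uniq.
Qed.

(** The value of [H*] at the identity is the sequence of degrees, and undoing its
[n + 1] differences of lag [1] gives back the number of lattice points. *)
Lemma effective_polynomial (R : realType) (n : nat) :
  Hstar_effective R n.+1 -> Hstar_polynomial R n.+1.
Proof.
move=> eff.
have h1 i : exists k : nat, Hstar_coef R i (1 : 'S_n.+1)%g = k%:R.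
  have /Cnat_char1 := eff i; rewrite HstarE => /natrP [k kE].
  exists k; apply: (fmorph_inj (ratr : rat -> algC)).
  by rewrite /= kE ratr_nat.
pose h i := xget 0%N [set k : nat | Hstar_coef R i (1 : 'S_n.+1)%g = k%:R].
have hE i : Hstar_coef R i (1 : 'S_n.+1)%g = (h i)%:R.
  by rewrite /h; case: xgetP => // H; have [k kE] := h1 i; case: (H k).
pose u i : rat := (h i)%:R.
have uE : u =1 iter n.+1 (lag_diff 1) (fun t => (lattice_char R t (1 : 'S_n.+1)%g)%:R).
  move=> i; rewrite /u -hE.
  have := Hstar_coef_block_cycle R 0 n i; rewrite block_cycle1.
  by rewrite iterSr.
have bnd t : iter n.+1 partial_sum u t <= n.+1%:R ^+ n * t.+1%:R ^+ n.
  have -> : iter n.+1 partial_sum u t = (lattice_char R t (1 : 'S_n.+1)%g)%:R.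
    rewrite -[RHS](iter_partial_sum_lag n.+1 (fun t => (lattice_char R t (1 : 'S_n.+1)%g)%:R)).
    elim: {1 2}n.+1 t => [|l IH] t /=; first exact: uE.
    exact: partial_sum_ext.
  rewrite -exprMn -natrM -natrX ler_nat.
  apply: leq_trans (lattice_char_bound _ _ _) _.
  by case: {2 4}n => // e; rewrite leq_exp2r //; nia.
have u0 i : 0 <= u i by rewrite ler0n.
have [B bndB] := partial_sum_bounded u0 bnd.
have B0 : 0 <= B by apply: le_trans (bndB 0%N); apply: sumr_ge0.
have [N Nh] : exists N, forall i, (N <= i)%N -> h i = 0%N.
  apply: (@eventually_zero h (Num.trunc B) 0) => t.
  case: t => [|t]; first by rewrite big_nil.
  rewrite big_mkord truncn_ge_nat // natr_sum; exact: bndB.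
exists N => i Ni; apply/eqP; rewrite -char1_eq0 //.
by rewrite HstarE hE Nh // rmorph0.
Qed.

(** * Lattice points fixed by a cycle *)

Lemma lattice_char_size (R : realType) (n t : nat) (g : 'S_n)
    (s : seq 'rV[int]_n) :
  uniq s ->
  (forall v, (v \in s) <->
    lattice_points (dilate t (@permutahedron R n)) v /\ col_perm g v = v) ->
  lattice_char R t g = size s.
Proof.
move=> us sP; rewrite /lattice_char.
have -> : [set v | lattice_points (dilate t (@permutahedron R n)) v
                        /\ col_perm g v = v] = [set` [fset v in s]%fset].
  apply/seteqP; split=> v /=; rewrite in_fset /=; first by move=> /sP.
  by move=> /sP.
by rewrite set_fsetK card_fseq undup_id.
Qed.

Lemma block_cycle_fixed (k m : nat) (v : 'rV[int]_(k.+1 + m)) :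
  col_perm (block_cycle k.+1 m) v = v <->
  exists a w, v = row_mx (const_mx a) w.
Proof.
split=> [/rowP fix_v|[a [w ->]]]; last first.
  apply/rowP => i; rewrite mxE; case: (split_ordP i) => j ->.
    by rewrite block_cycle_l !row_mxEl !mxE.
  by rewrite block_cycle_r.
exists (v 0 (lshift m ord0)), (rsubmx v); rewrite -[LHS]hsubmxK; congr row_mx.
apply/rowP => -[i ik]; rewrite !mxE.
elim: i ik => [|i IH] ik; first by congr (v _ (lshift _ _)); apply: val_inj.
have ik' : (i < k.+1)%N by apply: ltnW.
rewrite -(IH ik') -[RHS]fix_v mxE block_cycle_l; congr (v _ (lshift _ _)).
by apply: val_inj; rewrite /= modn_small.
Qed.

Lemma block_vector_lattice (R : realType) (k m t : nat) (a : int) (w : 'rV[int]_m)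
    (n := (k.+1 + m)%N) :
  lattice_points (dilate t (@permutahedron R n)) (row_mx (const_mx a) w) <->
  2 * (k.+1%:Z * a + \sum_i w 0 i) = (t * (n * n.+1))%:Z /\
  forall S : {set 'I_m}, (t * (#|S| * #|S|.+1))%:Z <= 2 * \sum_(i in S) w 0 i
    /\ (t * ((k.+1 + #|S|) * (k.+1 + #|S|).+1))%:Z
         <= 2 * (k.+1%:Z * a + \sum_(i in S) w 0 i).
Proof.
rewrite lattice_dilateP.
have sumE (S : {set 'I_n}) : let L := [set i | lshift m i \in S]%SET in
    let U := [set i | rshift k.+1 i \in S]%SET in
    #|S| = (#|L| + #|U|)%N /\
    \sum_(i in S) (row_mx (const_mx a) w : 'rV[int]_n) 0 i =
      #|L|%:Z * a + \sum_(i in U) w 0 i.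
  rewrite /= -!sum1_card; split.
    rewrite big_split_ord /=; congr (_ + _)%N; apply: eq_bigl => i; by rewrite inE.
  rewrite big_split_ord /=; congr (_ + _).
    rewrite -natz mulr_natl sum1_card -sumr_const.
    by apply: eq_big => [i|i _]; rewrite ?inE // row_mxEl mxE.
  by apply: eq_big => [i|i _]; rewrite ?inE // row_mxEr.
have tot_sum : \sum_i (row_mx (const_mx a) w : 'rV[int]_n) 0 i =
    k.+1%:Z * a + \sum_i w 0 i.
  rewrite big_split_ord /=; under eq_bigr do rewrite row_mxEl mxE.
  rewrite sumr_const card_ord -mulr_natl natz; congr (_ + _).
  by under eq_bigr do rewrite row_mxEr.
rewrite tot_sum.
split=> -[tot dom]; split=> // S.
  pose r (T : {set 'I_k.+1}) := [set i : 'I_n |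
     match fintype.split i with inl b => b \in T | inr b => b \in S end]%SET.
  have rl T : [set i | lshift m i \in r T]%SET = T.
    by apply/setP => i; rewrite !inE (unsplitK (inl i)).
  have rr T : [set i | rshift k.+1 i \in r T]%SET = S.
    by apply/setP => i; rewrite !inE (unsplitK (inr i)).
  split.
    have := dom (r finset.set0); have [-> ->] := sumE (r finset.set0).
    by rewrite rl rr cards0 mul0r !add0r add0n.
  have := dom (r [set: 'I_k.+1]%SET); have [-> ->] := sumE (r [set: 'I_k.+1]%SET).
  by rewrite rl rr cardsT card_ord.
have [-> ->] := sumE S.
set L := [set i | _]%SET; set U := [set i | rshift _ _ \in _]%SET.
have [d1 d2] := dom U.
have : (#|L| <= k.+1)%N by rewrite -[X in (_ <= X)%N]card_ord max_card.
move: #|L| #|U| (\sum_(i in U) _) d1 d2 => l u s d1 d2 lk.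
(* The left-hand side of [d1] and [d2] is a convex function of the number of
   coordinates of the block that are counted, and the right-hand side is
   affine. *)
rewrite -(ler_pM2l (ltr0Sn _ k)) natz.
have [r Kr] : exists r, k.+1 = (l + r)%N by exists (k.+1 - l)%N; lia.
rewrite Kr in d2 *; clear -d1 d2.
have e1 := ler_wpM2l (isT : 0 <= r%:Z) d1.
have e2 := ler_wpM2l (isT : 0 <= l%:Z) d2.
have e3 : 0 <= (t * (l + r) * l * r)%N%:Z by [].
by nia.
Qed.

(** The lattice points fixed by a cycle of length [K = k.+1] are the vectors
[(a, ..., a, w)]. The inequalities for the whole block and for its complement
bound [a] by [t (K + 1) <= 2 a <= t (K + 2 m + 1)], so that
[2 a = t (K + 2 m + 1) - 2 j - e], where [e] is the parity of [t (K + 1)];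
slicing by [j] leaves the coordinates [w] to be counted. *)
Lemma lattice_char_slices (R : realType) (k m t : nat)
    (W : nat -> seq 'rV[int]_m) (e := nat_of_bool (odd (t * k))) :
  (forall j, (j < (m * t).+1 - e)%N -> uniq (W j) /\ forall w, w \in W j <->
     2 * \sum_i w 0 i = (t * (m * m.+1) + k.+1 * (2 * j + e))%:Z /\
     forall S : {set 'I_m}, (t * (#|S| * #|S|.+1))%:Z <= 2 * \sum_(i in S) w 0 i
       <= (t * (#|S| * (2 * (k.+1 + m) + 1 - #|S|)))%:Z) ->
  lattice_char R t (block_cycle k.+1 m) =
    (\sum_(j < (m * t).+1 - e) size (W j))%N.
Proof.
move=> HW.
pose J := ((m * t).+1 - e)%N.
pose A j : int := ((t * (k.+1 + 2 * m + 1))./2 - j)%N%:Z.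
have tk : odd (t * (k.+1 + 2 * m + 1)) = odd (t * k).
  by rewrite !oddM addn1 addSn /= negbK oddD mul2n odd_double addbF.
have eE : (t * (k.+1 + 2 * m + 1) = e + 2 * (t * (k.+1 + 2 * m + 1))./2)%N.
  by rewrite /e -tk [(2 * _./2)%N]mul2n odd_double_half.
have AE j : (j < J)%N -> 2 * A j = (t * (k.+1 + 2 * m + 1))%N%:Z - (2 * j + e)%N%:Z.
  by rewrite /J /A => jJ; move: eE; move: (_./2) => q; nia.
pose F j (w : 'rV[int]_m) : 'rV[int]_(k.+1 + m) := row_mx (const_mx (A j)) w.
pose s := [seq F j w | j <- iota 0 J, w <- W j].
have -> : (\sum_(j < J) size (W j))%N = size s.
  rewrite size_allpairs_dep sumnE big_map -(big_mkord xpredT (fun j => size (W j))).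
  by rewrite /index_iota subn0.
have total_split : (t * ((k.+1 + m) * (k.+1 + m).+1) =
    k.+1 * (t * (k.+1 + 2 * m + 1)) + t * (m * m.+1))%N by ring.
have compl (S : {set 'I_m}) (w : 'rV[int]_m) :
    \sum_i w 0 i = \sum_(i in S) w 0 i + \sum_(i in ~: S) w 0 i.
  by rewrite (bigID (mem S)) /=; congr (_ + _); apply: eq_bigl => i; rewrite !inE.
have cardC (S : {set 'I_m}) : m = (#|S| + #|~: S|)%N.
  by rewrite cardsC card_ord.
apply: lattice_char_size.
  apply: allpairs_uniq_dep; first exact: iota_uniq.
    by move=> j; rewrite mem_iota add0n => /andP[_ /HW[]].
  move=> _ _ /allpairsPdep [j [w [jJ _ ->]]] /allpairsPdep [j' [w' [jJ' _ ->]]] /=.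
  move: jJ jJ'; rewrite !mem_iota !add0n => /andP[_ /AE jJ] /andP[_ /AE jJ'].
  move=> /eq_row_mx [/rowP /(_ ord0)]; rewrite !mxE => AA ->.
  suff -> : j = j' by [].
  by move: jJ jJ'; rewrite AA => ->; lia.
move=> v; split.
  move=> /allpairsPdep [j [w [jJ wW ->]]].
  move: jJ; rewrite mem_iota add0n => /andP[_ jJ].
  split; last by apply/block_cycle_fixed; exists (A j), w.
  apply/block_vector_lattice.
  have [_ /(_ w) [/(_ wW) [tot dom] _]] := HW j jJ.
  have tot' : 2 * (k.+1%:Z * A j + \sum_i w 0 i) =
      (t * ((k.+1 + m) * (k.+1 + m).+1))%:Z.
    rewrite mulrDr tot mulrCA (AE j jJ) total_split.
    move: (t * (k.+1 + 2 * m + 1))%N (t * (m * m.+1))%N (2 * j + e)%N => x y z.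
    by clear; nia.
  split=> // S; split; first by have /andP[] := dom S.
  have /andP[_] := dom (~: S)%SET.
  move: tot' (cardC S); rewrite (compl S).
  move: #|S| #|(~: S)%SET| (\sum_(i in S) _) (\sum_(i in ~: S) _) (A j).
  by clear => c c' s s' a tot' mE; rewrite mE; nia.
move=> [Lv /block_cycle_fixed [a [w vE]]].
move: Lv; rewrite vE => /block_vector_lattice [tot dom].
have a_lo : (t * k.+2)%N%:Z <= 2 * a.
  have := proj2 (dom finset.set0).
  rewrite cards0 big_set0 addn0 addr0 => d0.
  by rewrite -(ler_pM2l (ltr0Sn _ k)) natz; nia.
have a_hi : 2 * a <= (t * (k.+1 + 2 * m + 1))%N%:Z.
  have := proj1 (dom [set: 'I_m]%SET).
  rewrite cardsT card_ord; under eq_bigl do rewrite inE.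
  move: tot; move: (\sum_i _) => z; clear => tot d1.
  by rewrite -(ler_pM2l (ltr0Sn _ k)) natz; nia.
have [j [jJ aE]] : exists j, (j < J)%N /\ A j = a.
  exists (absz ((t * (k.+1 + 2 * m + 1))./2%:Z - a)).
  move: eE a_lo a_hi; rewrite /J /A.
  have : (e <= 1)%N by rewrite /e; case: odd.
  by move: (_./2); clear => h; nia.
apply/allpairsPdep; exists j, w; split; last by rewrite /F aE.
  by rewrite mem_iota add0n.
have [_ /(_ w) [_]] := HW j jJ; apply.
have := AE j jJ; rewrite aE => aj.
split.
  move: tot; rewrite mulrDr mulrCA aj total_split.
  move: (t * (k.+1 + 2 * m + 1))%N (t * (m * m.+1))%N (2 * j + e)%N => x y z.
  by move: (\sum_i _) => q; clear; nia.
move=> S; rewrite (proj1 (dom S)) /=.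
have := proj2 (dom (~: S)%SET); move: tot.
move: (cardC S); rewrite (compl S).
move: #|S| #|(~: S)%SET| (\sum_(i in S) _) (\sum_(i in ~: S) _).
by clear => c c' s s' mE; rewrite mE; nia.
Qed.

Definition int_vec (m : nat) (s : seq int) : 'rV[int]_m := \row_i s`_i.

Lemma int_vec2P (w : 'rV[int]_2) : exists b c, w = int_vec 2 [:: b; c].
Proof.
exists (w 0 0), (w 0 1); apply/rowP => i; rewrite mxE.
by case: i => -[|[|//]] i2 /=; congr (w _ _); apply: val_inj.
Qed.

Lemma int_vec3P (w : 'rV[int]_3) : exists b c d, w = int_vec 3 [:: b; c; d].
Proof.
exists (w 0 0), (w 0 1), (w 0 2); apply/rowP => i; rewrite mxE.
by case: i => -[|[|[|//]]] i3 /=; congr (w _ _); apply: val_inj.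
Qed.

Lemma subset_sums2 (P : nat -> int -> Prop) (b c : int) :
  (forall S : {set 'I_2}, P #|S| (\sum_(i in S) int_vec 2 [:: b; c] 0 i)) <->
  (forall x y : bool, P (x + y)%N ((if x then b else 0) + (if y then c else 0))).
Proof.
split=> H.
  move=> x y; have := H [set i : 'I_2 | nth false [:: x; y] i]%SET.
  rewrite -sum1_card !(big_mkcond (fun i => i \in _)) !big_ord_recl !big_ord0 !inE !mxE /=.
  by rewrite addn0 addr0; case: x; case: y.
move=> S; have := H (ord0 \in S) (lift ord0 ord0 \in S).
rewrite -sum1_card !(big_mkcond (fun i => i \in _)) !big_ord_recl !big_ord0 !mxE /=.
by rewrite addn0 addr0; case: (_ \in _); case: (_ \in _).
Qed.

Lemma subset_sums3 (P : nat -> int -> Prop) (b c d : int) :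
  (forall S : {set 'I_3}, P #|S| (\sum_(i in S) int_vec 3 [:: b; c; d] 0 i)) <->
  (forall x y z : bool, P (x + (y + z))%N
    ((if x then b else 0) + ((if y then c else 0) + (if z then d else 0)))).
Proof.
split=> H.
  move=> x y z; have := H [set i : 'I_3 | nth false [:: x; y; z] i]%SET.
  rewrite -sum1_card !(big_mkcond (fun i => i \in _)) !big_ord_recl !big_ord0 !inE !mxE /=.
  by rewrite addn0 addr0; case: x; case: y; case: z.
move=> S; have := H (ord0 \in S) (lift ord0 ord0 \in S) (lift ord0 (lift ord0 ord0) \in S).
rewrite -sum1_card !(big_mkcond (fun i => i \in _)) !big_ord_recl !big_ord0 !mxE /=.
by rewrite addn0 addr0; case: (_ \in _); case: (_ \in _); case: (_ \in _).
Qed.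

Lemma sum_quadratic (N : nat) (a b c : rat) :
  \sum_(i < N) (a + b * i%:R + c * i%:R ^+ 2) =
  a * N%:R + b * (N%:R * (N%:R - 1) / 2) + c * (N%:R * (N%:R - 1) * (2 * N%:R - 1) / 6).
Proof.
elim: N => [|N IH]; first by rewrite big_ord0; field.
by rewrite big_ord_recr /= IH -natr1; field.
Qed.

Lemma sum_affine (N : nat) (a b : rat) :
  \sum_(i < N) (a + b * i%:R) = a * N%:R + b * (N%:R * (N%:R - 1) / 2).
Proof.
have := sum_quadratic N a b 0; rewrite mul0r addr0 => <-.
by apply: eq_bigr => i _; rewrite mul0r addr0.
Qed.

(** With [b = t + x], the slice is [x + y = s] with [x] and [y] in the interval
[[0, (K + 1) t]], where [K = k.+1] is the length of the cycle. *)
Lemma lattice_char2 (R : realType) (k t : nat) (e := nat_of_bool (odd (t * k)))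
    (s := fun j => (t + k.+1 * j + (k.+1 * e)./2)%N) :
  ~~ odd (k.+1 * e) ->
  lattice_char R t (block_cycle k.+1 2) =
  (\sum_(j < (2 * t).+1 - e)
     ((minn (k.+2 * t) (s j)).+1 - (s j - k.+2 * t)))%N.
Proof.
move=> ke; pose W j := [seq int_vec 2 [:: (t + x)%N%:Z; (t + s j - x)%N%:Z]
  | x <- iota (s j - k.+2 * t) ((minn (k.+2 * t) (s j)).+1 - (s j - k.+2 * t))].
rewrite (@lattice_char_slices R k 2 t W).
  by apply: eq_bigr => j _; rewrite size_map size_iota.
move=> j jJ; rewrite -/e.
have sE : (2 * s j = 2 * t + k.+1 * (2 * j + e))%N.
  have := odd_double_half (k.+1 * e); rewrite (negPf ke) /s -mul2n; nia.
have sj : (t <= s j)%N by rewrite /s; lia.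
have e1 : (e <= 1)%N by rewrite /e; case: odd.
have sj2 : (s j <= (2 * k + 3) * t)%N.
  by move: jJ sE e1; rewrite -/e; move: (s j); clear; nia.
have h1 : (t * (1 * (2 * (k.+1 + 2) + 1 - 1)) = 2 * (k * t) + 6 * t)%N.
  have -> : (2 * (k.+1 + 2) + 1 - 1 = 2 * k + 6)%N by lia.
  by ring.
have h2 : (t * (2 * (2 * (k.+1 + 2) + 1 - 2)) = 4 * (k * t) + 10 * t)%N.
  have -> : (2 * (k.+1 + 2) + 1 - 2 = 2 * k + 5)%N by lia.
  by ring.
have h3 : (k.+2 * t = k * t + 2 * t)%N by ring.
rewrite mulnDl -mulnA in sj2.
split.
  rewrite map_inj_in_uniq ?iota_uniq // => x y _ _ /rowP /(_ 0).
  by rewrite !mxE /= => -[]; lia.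
move=> w; have [b [c ->]] := int_vec2P w.
have -> : \sum_i int_vec 2 [:: b; c] 0 i = b + c.
  by rewrite !big_ord_recl big_ord0 !mxE /= addr0.
rewrite (subset_sums2 (fun n z => (t * (n * n.+1))%:Z <= 2 * z
       <= (t * (n * (2 * (k.+1 + 2) + 1 - n)))%:Z)).
split.
  move=> /mapP [x]; rewrite mem_iota h3 => xs /rowP vE.
  have := vE 0; have := vE 1; rewrite !mxE /= => -> ->.
  move: sE sj sj2 xs; move: (s j) (k * t)%N h1 h2 => q z h1 h2 sE sj sj2 xs.
  split; first by lia.
  by move=> [] [] /=; rewrite ?(add0n, addn0, h1, h2); lia.
move=> [tot dom].
have := dom true true; have := dom true false; have := dom false true => /=.
rewrite ?(add0n, addn0, h1, h2) => d1 d2 d3.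
apply/mapP; exists (absz (b - t%:Z)).
  by rewrite mem_iota h3; move: (k * t)%N h1 h2 sj2 d1 d2 d3 => z h1 h2 sj2 d1 d2 d3; lia.
by congr (int_vec 2 [:: _; _]); lia.
Qed.

(** The plane section [x + y + z = s] of the cube of side [U], which is a hexagon
for [U <= s <= 2 U], projected to [(x, y)]. *)
Definition tri (U s : nat) : seq (nat * nat) :=
  [seq (x, y) | x <- iota 0 U.+1,
                y <- iota (s - U - x) ((minn U (s - x)).+1 - (s - U - x))].

Lemma mem_tri (U s x y : nat) : (U <= s)%N ->
  ((x, y) \in tri U s) = [&& x <= U, y <= U, x + y <= s & s <= U + (x + y)]%N.
Proof.
move=> Us; apply/allpairsPdep/idP.
  by move=> [x' [y' [+ + [-> ->]]]]; rewrite !mem_iota; lia.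
by move=> H; exists x, y; rewrite !mem_iota; split=> //; lia.
Qed.

Lemma tri_uniq (U s : nat) : uniq (tri U s).
Proof.
apply: allpairs_uniq_dep => [|x _|]; rewrite ?iota_uniq //.
by move=> [x y] [x' y'] _ _ /= [-> ->].
Qed.

(** The hexagon is the triangle of the nonnegative solutions of [x + y + z = s]
without its three corners. *)
Lemma size_tri (U s : nat) : (U <= s <= 2 * U)%N ->
  (size (tri U s))%:R = ((s%:R + 1) * (s%:R + 2) -
     3 * (s%:R - U%:R) * (s%:R - U%:R + 1)) / 2 :> rat.
Proof.
move=> /andP[Us sU].
rewrite size_allpairs_dep sumnE big_map.
rewrite (eq_bigr (fun x => (minn U (s - x)).+1 - (s - U - x))%N); last first.
  by move=> x _; rewrite size_iota.
rewrite -[iota 0 _]/(index_iota 0 U.+1).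
have -> : U.+1 = ((s - U) + (2 * U - s).+1)%N by lia.
rewrite big_mkord big_split_ord /= natrD !natr_sum.
rewrite (eq_bigr (fun i : 'I_(s - U) => (2 * U%:R - s%:R + 1) + 1 * i%:R : rat)); last first.
  move=> i _; have := ltn_ord i => ip.
  have -> : ((minn U (s - i)).+1 - (s - U - i) = 2 * U + 1 + i - s)%N by lia.
  by rewrite natrB ?natrD ?natrM; [ring|lia].
rewrite [X in _ + X](eq_bigr (fun i : 'I_(2 * U - s).+1 => (U%:R + 1) + (-1) * i%:R : rat)); last first.
  move=> i _; have := ltn_ord i => ip.
  have -> : ((minn U (s - (s - U + i))).+1 - (s - U - (s - U + i)) = U + 1 - i)%N by lia.
  by rewrite natrB ?natrD; [ring|lia].
rewrite !sum_affine -[(2 * U - s).+1%:R]natr1 !natrB // natrM.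
by field.
Qed.

(** With [b = t + x], the slice is the hexagon [x + y + z = s] with [x], [y]
and [z] in [[L, U]]: the facets given by one coordinate and those
given by two coordinates compete for the two bounds. *)
Lemma lattice_char3 (R : realType) (k t : nat) (e := nat_of_bool (odd (t * k)))
    (s := fun j => (3 * t + k.+1 * j + (k.+1 * e)./2)%N)
    (L := fun j => (s j - (2 * k + 5) * t)%N)
    (U := fun j => minn ((k + 3) * t) (s j - t)) :
  ~~ odd (k.+1 * e) ->
  lattice_char R t (block_cycle k.+1 3) =
  (\sum_(j < (3 * t).+1 - e) size (tri (U j - L j) (s j - 3 * L j)))%N.
Proof.
move=> ke; pose W j := [seq int_vec 3 [:: (t + L j + p.1)%N%:Z; (t + L j + p.2)%N%:Z;
   (t + s j - 2 * L j - p.1 - p.2)%N%:Z] | p <- tri (U j - L j) (s j - 3 * L j)].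
rewrite (@lattice_char_slices R k 3 t W).
  by apply: eq_bigr => j _; rewrite size_map.
move=> j jJ; rewrite -/e.
have sE : (2 * s j = 6 * t + k.+1 * (2 * j + e))%N.
  have := odd_double_half (k.+1 * e); rewrite (negPf ke) /s -mul2n; nia.
have sj : (3 * t <= s j)%N by rewrite /s; lia.
have e1 : (e <= 1)%N by rewrite /e; case: odd.
have sj2 : (s j <= (3 * k + 6) * t)%N.
  by move: jJ sE e1; rewrite -/e; move: (s j); clear; nia.
have h1 : (t * (1 * (2 * (k.+1 + 3) + 1 - 1)) = 2 * (k * t) + 8 * t)%N.
  have -> : (2 * (k.+1 + 3) + 1 - 1 = 2 * k + 8)%N by lia.
  by ring.
have h2 : (t * (2 * (2 * (k.+1 + 3) + 1 - 2)) = 4 * (k * t) + 14 * t)%N.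
  have -> : (2 * (k.+1 + 3) + 1 - 2 = 2 * k + 7)%N by lia.
  by ring.
have h3 : (t * (3 * (2 * (k.+1 + 3) + 1 - 3)) = 6 * (k * t) + 18 * t)%N.
  have -> : (2 * (k.+1 + 3) + 1 - 3 = 2 * k + 6)%N by lia.
  by ring.
have LE : (L j = s j - (2 * (k * t) + 5 * t))%N by rewrite /L mulnDl -mulnA.
have UE : (U j = minn (k * t + 3 * t) (s j - t))%N by rewrite /U mulnDl.
rewrite mulnDl -mulnA in sj2.
clearbody L U s e.
have Us : (U j - L j <= s j - 3 * L j)%N.
  by rewrite LE UE; move: (k * t)%N (s j) sj sj2; clear=> z q sj sj2; lia.
split.
  rewrite map_inj_in_uniq ?tri_uniq // => -[x y] [x' y'] _ _ /rowP vE.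
  by have := vE 0; have := vE 1; rewrite !mxE /= => -[/addnI ->] [/addnI ->].
move=> w; have [b [c [d ->]]] := int_vec3P w.
have -> : \sum_i int_vec 3 [:: b; c; d] 0 i = b + (c + d).
  by rewrite !big_ord_recl big_ord0 !mxE /= addr0.
rewrite (subset_sums3 (fun n z => (t * (n * n.+1))%:Z <= 2 * z
       <= (t * (n * (2 * (k.+1 + 3) + 1 - n)))%:Z)).
split.
  move=> /mapP [[x y]]; rewrite mem_tri // => xy /rowP vE.
  have := vE 0; have := vE 1; have := vE 2; rewrite !mxE /=.
  have [x' [y' [z' [-> -> ->]]]] : exists x' y' z',
      [/\ (t + s j - 2 * L j - x - y = t + z')%N, (t + L j + y = t + y')%N,
          (t + L j + x = t + x')%N &
       [/\ (x' + y' + z' = s j)%N,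
        [&& x' <= k * t + 3 * t, x' + t <= s j & s j <= x' + 2 * (k * t) + 5 * t]%N,
        [&& y' <= k * t + 3 * t, y' + t <= s j & s j <= y' + 2 * (k * t) + 5 * t]%N &
        [&& z' <= k * t + 3 * t, z' + t <= s j & s j <= z' + 2 * (k * t) + 5 * t]%N]].
    exists (L j + x)%N, (L j + y)%N, (s j - 2 * L j - x - y)%N.
    move: LE UE sj sj2 xy; move: (L j) (U j) (s j) (k * t)%N.
    by clear=> l u q z lE uE sj sj2 xy; split; [lia|lia|lia|split; lia].
  move: (k * t)%N (s j) (k.+1 * (2 * j + e))%N h1 h2 h3 sE sj sj2.
  clear=> z q p h1 h2 h3 sE sj sj2 [sq xq yq zq] -> -> ->.
  split; first by lia.
  by move=> [] [] [] /=; rewrite ?(add0n, addn0, h1, h2, h3); clear h1 h2 h3; lia.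
move=> [tot dom].
have := dom true true true; have := dom true true false; have := dom false true true.
have := dom true false true; have := dom true false false; have := dom false true false.
have := dom false false true => /=.
rewrite ?(add0n, addn0, h1, h2, h3) => d1 d2 d3 d4 d5 d6 d7.
have [x' [y' [z' [bE cE dE [sq xq yq zq]]]]] : exists x' y' z',
      [/\ b = (t + x')%N%:Z, c = (t + y')%N%:Z, d = (t + z')%N%:Z &
       [/\ (x' + y' + z' = s j)%N,
        [&& x' <= k * t + 3 * t, x' + t <= s j & s j <= x' + 2 * (k * t) + 5 * t]%N,
        [&& y' <= k * t + 3 * t, y' + t <= s j & s j <= y' + 2 * (k * t) + 5 * t]%N &
        [&& z' <= k * t + 3 * t, z' + t <= s j & s j <= z' + 2 * (k * t) + 5 * t]%N]].
  exists (absz (b - t%:Z)), (absz (c - t%:Z)), (absz (d - t%:Z)).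
  clear h1 h2 h3 dom; move: tot d1 d2 d3 d4 d5 d6 d7 sE.
  move: (k * t)%N (s j) (k.+1 * (2 * j + e))%N.
  clear=> z q p tot d1 d2 d3 d4 d5 d6 d7 sE.
  by split; [lia|lia|lia|split; lia].
apply/mapP; exists ((x' - L j)%N, (y' - L j)%N).
  rewrite mem_tri //; move: LE UE sq xq yq zq sj sj2.
  move: (L j) (U j) (s j) (k * t)%N.
  by clear=> l u q z lE uE sq xq yq zq sj sj2; lia.
rewrite bE cE dE; congr (int_vec 3 [:: Posz _; Posz _; Posz _]) => /=;
  move: LE UE sq xq yq zq sj sj2; move: (L j) (U j) (s j) (k * t)%N;
  by clear=> l u q z lE uE sq xq yq zq sj sj2; lia.
Qed.

(** The sum over the slices is a trapezoidal sum when [e = 0], and a midpoint sum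
when [e = 1]; this is why the two closed forms differ. *)
Lemma lattice_char2E (R : realType) (k t : nat) (e := nat_of_bool (odd (t * k))) :
  ~~ odd (k.+1 * e) ->
  (lattice_char R t (block_cycle k.+1 2))%:R =
  (k%:R + 3) * t%:R ^+ 2 + (3 - e%:R) * t%:R + (1 - e%:R) :> rat.
Proof.
move=> ke; rewrite lattice_char2 // -/e.
have hE : k.+1%:R * e%:R = 2 * (k.+1 * e)./2%:R :> rat.
  have := odd_double_half (k.+1 * e); rewrite (negPf ke) -mul2n add0n => h.
  by rewrite -!natrM h.
have hK : (2 * (k.+1 * e)./2 <= k.+1 /\ 2 * (k.+1 * e)./2 = k.+1 * e)%N.
  have := odd_double_half (k.+1 * e); rewrite (negPf ke) -mul2n add0n => ->.
  by split=> //; rewrite /e; case: odd; rewrite ?muln0 ?muln1.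
have e1 : (e <= 1)%N by rewrite /e; case: odd.
clearbody e; move: (_./2) hE hK => h hE [hK h2].
have -> : ((2 * t).+1 - e = t + (t.+1 - e))%N by lia.
rewrite big_split_ord /= natrD !natr_sum.
rewrite (eq_bigr (fun i : 'I_t => (t%:R + h%:R + 1) + k.+1%:R * i%:R : rat)); last first.
  move=> i _; have := leq_mul (leqnn k.+1) (ltn_ord i); rewrite mulnS => it.
  have -> : ((minn (k.+2 * t) (t + k.+1 * i + h)).+1 - (t + k.+1 * i + h - k.+2 * t)
    = t + h + 1 + k.+1 * i)%N by rewrite [(k.+2 * t)%N]mulSn; lia.
  by rewrite !natrD natrM; ring.
rewrite [X in _ + X](eq_bigr (fun i : 'I_(t.+1 - e) =>
  (k.+2%:R * t%:R - h%:R + 1) + (- k.+1%:R) * i%:R : rat)); last first.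
  move=> i _.
  have it : (k.+1 * (i + e) <= k.+1 * t)%N.
    by rewrite leq_mul2l; have := ltn_ord i; lia.
  have -> : ((minn (k.+2 * t) (t + k.+1 * (t + i) + h)).+1 - (t + k.+1 * (t + i) + h - k.+2 * t)
    = k.+2 * t + 1 - (h + k.+1 * i))%N.
    by move: it; rewrite [(k.+2 * t)%N]mulSn !mulnDr; lia.
  rewrite natrB ?natrD ?natrM; last first.
    by move: it; rewrite [(k.+2 * t)%N]mulSn mulnDr; lia.
  by ring.
rewrite !sum_affine.
have -> : h%:R = k.+1%:R * e%:R / 2 :> rat by rewrite hE; field.
rewrite natrB; last by lia.
rewrite -[t.+1%:R]natr1 -[k.+2%:R]natr1 -[k.+1%:R]natr1.
by field.
Qed.

Lemma lattice_char3E (R : realType) (k t : nat) (e := nat_of_bool (odd (t * k))) :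
  ~~ odd (k.+1 * e) ->
  (lattice_char R t (block_cycle k.+1 3))%:R =
  (k%:R + 4) ^+ 2 * t%:R ^+ 3 + (3 * k%:R + 15 - 3 * e%:R) * t%:R ^+ 2
  + (6 - 3 * e%:R) * t%:R + (1 - e%:R) :> rat.
Proof.
move=> ke; rewrite lattice_char3 // -/e.
have mE a b : ((a * k + b) * t = a * (k * t) + b * t)%N.
  by rewrite mulnDl mulnA.
have hE : k.+1%:R * e%:R = 2 * (k.+1 * e)./2%:R :> rat.
  have := odd_double_half (k.+1 * e); rewrite (negPf ke) -mul2n add0n => h.
  by rewrite -!natrM h.
have hK : (2 * (k.+1 * e)./2 <= k.+1 /\ 2 * (k.+1 * e)./2 = k.+1 * e)%N.
  have := odd_double_half (k.+1 * e); rewrite (negPf ke) -mul2n add0n => ->.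
  by split=> //; rewrite /e; case: odd; rewrite ?muln0 ?muln1.
have e1 : (e <= 1)%N by rewrite /e; case: odd.
clearbody e; move: (_./2) hE hK => h hE [hK h2].
have -> : ((3 * t).+1 - e = (t + t) + (t.+1 - e))%N by lia.
rewrite !big_split_ord /= !natrD !natr_sum.
set K : rat := k%:R + 1; set T : rat := t%:R; set H : rat := h%:R.
have KE : K = k.+1%:R by rewrite -natr1.
pose P (s : rat) := ((s + 1) * (s + 2) - 3 * T * (T + 1)) / 2.
rewrite (eq_bigr (fun i : 'I_t => P (3 * T + H) +
    K * (2 * (3 * T + H) + 3) / 2 * i%:R + K ^+ 2 / 2 * i%:R ^+ 2)); last first.
  move=> i _; have := leq_mul (leqnn k.+1) (ltn_ord i); rewrite mulnS => it.
  set s := (3 * t + k.+1 * i + h)%N.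
  have -> : (s - (2 * k + 5) * t = 0)%N by rewrite /s mulnDl; nia.
  have -> : (minn ((k + 3) * t) (s - t) = s - t)%N by rewrite /s mulnDl; nia.
  rewrite subn0 muln0 subn0 size_tri; last by rewrite /s; lia.
  rewrite natrB; last by rewrite /s; lia.
  by rewrite /s !(natrD, natrM) /P /K /T /H; field.
rewrite [X in _ + X + _](eq_bigr (fun i : 'I_t =>
   (((3 + K) * T + H + 1) * ((3 + K) * T + H + 2) - 3 * (T + H) * (T + H + 1)) / 2 +
   K * (2 * ((3 + K) * T + H) + 3 - 3 * (2 * (T + H) + 1)) / 2 * i%:R
   + (- K ^+ 2) * i%:R ^+ 2)); last first.
  move=> i _; have := leq_mul (leqnn k.+1) (ltn_ord i); rewrite mulnS => it.
  set s := (3 * t + k.+1 * (t + i) + h)%N.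
  have -> : (s - (2 * k + 5) * t = 0)%N by rewrite /s mulnDl mulnDr; nia.
  have -> : (minn ((k + 3) * t) (s - t) = (k + 3) * t)%N by rewrite /s mulnDl mulnDr; nia.
  rewrite subn0 muln0 subn0 size_tri; last by rewrite /s mulnDl mulnDr; nia.
  by rewrite /s !(natrD, natrM) /K /T /H; field.
rewrite [X in _ + X](eq_bigr (fun i : 'I_(t.+1 - e) => P ((K + 3) * T - H) +
    (- K * (2 * ((K + 3) * T - H) + 3) / 2) * i%:R + K ^+ 2 / 2 * i%:R ^+ 2)); last first.
  move=> i _.
  have it : (k.+1 * (i + e) <= k.+1 * t)%N.
    by rewrite leq_mul2l; have := ltn_ord i; lia.
  rewrite mulnDr -h2 in it.
  set s := (3 * t + k.+1 * (t + t + i) + h)%N.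
  have sl : ((2 * k + 5) * t <= s)%N by rewrite /s mulnDl !mulnDr; nia.
  have su : (s <= (3 * k + 6) * t)%N by rewrite /s mulnDl !mulnDr; nia.
  have -> : (minn ((k + 3) * t) (s - t) = (k + 3) * t)%N by rewrite /s mulnDl !mulnDr; nia.
  have -> : ((k + 3) * t - (s - (2 * k + 5) * t) = (3 * k + 8) * t - s)%N.
    by move: sl su; clearbody s; clear -mE; rewrite (mulnDl k 3) !mE; move: (k * t)%N => z; lia.
  have -> : (s - 3 * (s - (2 * k + 5) * t) = (6 * k + 15) * t - 2 * s)%N.
    by move: sl su; clearbody s; clear -mE; rewrite !mE; move: (k * t)%N => z; lia.
  have s8 : (s <= (3 * k + 8) * t)%N by apply: leq_trans su _; rewrite leq_mul2r; lia.
  have s15 : (2 * s <= (6 * k + 15) * t)%N.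
    by move: su; clearbody s; clear -mE; rewrite !mE; move: (k * t)%N => z; lia.
  rewrite size_tri; last first.
    by move: sl su s8 s15; clearbody s; clear -mE; rewrite !mE; move: (k * t)%N => z; lia.
  rewrite !natrB // /s !(natrD, natrM) /P /K /T /H.
  by field.
rewrite !sum_quadratic.
have -> : H = K * e%:R / 2 by rewrite KE hE; field.
rewrite natrB; last by lia.
rewrite -[t.+1%:R]natr1 /P -/T.
rewrite /T /K; clear -e1.
by case: e e1 => [|[|//]] _; field.
Qed.

(** * The series is not a polynomial in dimension at least three *)

Lemma polynomial_lag_diff (R : realType) (k m : nat) :
  Hstar_polynomial R (k.+1 + m) -> exists N, forall i, (N <= i)%N ->
  iter m (lag_diff 1) (lag_diff k.+1
    (fun t => (lattice_char R t (block_cycle k.+1 m))%:R)) i = 0.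
Proof.
move=> [N HN]; exists N => i Ni; rewrite -Hstar_coef_block_cycle.
have /cfunP /(_ (block_cycle k.+1 m)) := HN i Ni.
by rewrite HstarE [RHS]cfunE -(rmorph0 (ratr : {rmorphism rat -> algC})) => /fmorph_inj.
Qed.

Lemma lag_diff1S (u : nat -> rat) (t : nat) : lag_diff 1 u t.+1 = u t.+1 - u t.
Proof. by rewrite /lag_diff /= subn1. Qed.

Lemma lag_diffD (k : nat) (u : nat -> rat) (t : nat) :
  lag_diff k u (t + k) = u (t + k)%N - u t.
Proof. by rewrite /lag_diff leq_addl addnK. Qed.

(** If [H*] were a polynomial, the sequence of fixed-point counts would be
annihilated in the long run by the product of differences of lags [1], ...,
[1] and [k.+1]. On each parity class it is a polynomial in [t], but the two
polynomials differ by a term of positive degree, which survives those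
differences: the pole of the generating series at [-1] has larger order
than the zero of the denominator. *)
Lemma not_polynomial_2 (R : realType) (k : nat) :
  odd k -> ~ Hstar_polynomial R (k.+1 + 2).
Proof.
(* an index beyond [N] and beyond all the lags, of known parity *)
move=> ok /polynomial_lag_diff [N /(_ (2 * N + k.+1).+3)] /=.
set u := fun t => _.
pose P (t : nat) (e : rat) : rat :=
  (k%:R + 3) * t%:R ^+ 2 + (3 - e) * t%:R + (1 - e).
have uE t : u t = P t (odd t)%:R.
  rewrite /u lattice_char2E; last by rewrite oddM /= ok.
  by rewrite oddM ok andbT.
have p1 a : odd (2 * N + a) = odd a by rewrite oddD mul2n odd_double.
have p2 a b : odd (2 * N + a + b) = odd a (+) odd b by rewrite oddD p1.
have l3 : (2 * N + k.+1).+3 = (2 * N + 3 + k.+1)%N by lia.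
have l2 : (2 * N + k.+1).+2 = (2 * N + 2 + k.+1)%N by lia.
have l1 : (2 * N + k.+1).+1 = (2 * N + 1 + k.+1)%N by lia.
rewrite !lag_diff1S l3 l2 l1 !lag_diffD !uE !(p2, p1) /= ok /= => H.
have {H} H := H (_ : (N <= _)%N); have /eqP := H ltac:(lia).
rewrite /P /= (_ : _ - _ = - 2 * (k%:R + 1)); last first.
  by rewrite !(natrD, natrM) -[k.+1%:R]natr1; ring.
by rewrite mulf_eq0 oppr_eq0 /= natr1 pnatr_eq0.
Qed.

Lemma not_polynomial_3 (R : realType) (k : nat) :
  odd k -> ~ Hstar_polynomial R (k.+1 + 3).
Proof.
(* an index beyond [N] and beyond all the lags, of known parity *)
move=> ok /polynomial_lag_diff [N /(_ (2 * N + k.+1).+4)] /=.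
set u := fun t => _.
pose P (t : nat) (e : rat) : rat :=
  (k%:R + 4) ^+ 2 * t%:R ^+ 3 + (3 * k%:R + 15 - 3 * e) * t%:R ^+ 2
  + (6 - 3 * e) * t%:R + (1 - e).
have uE t : u t = P t (odd t)%:R.
  rewrite /u lattice_char3E; last by rewrite oddM /= ok.
  by rewrite oddM ok andbT.
have p1 a : odd (2 * N + a) = odd a by rewrite oddD mul2n odd_double.
have p2 a b : odd (2 * N + a + b) = odd a (+) odd b by rewrite oddD p1.
have l4 : (2 * N + k.+1).+4 = (2 * N + 4 + k.+1)%N by lia.
have l3 : (2 * N + k.+1).+3 = (2 * N + 3 + k.+1)%N by lia.
have l2 : (2 * N + k.+1).+2 = (2 * N + 2 + k.+1)%N by lia.
have l1 : (2 * N + k.+1).+1 = (2 * N + 1 + k.+1)%N by lia.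
rewrite !lag_diff1S l4 l3 l2 l1 !lag_diffD !uE !(p2, p1) /= ok /= => H.
have {H} H := H (_ : (N <= _)%N); have /eqP := H ltac:(lia).
rewrite /P /= (_ : _ - _ = 12 * (k%:R + 1) * (4 * N%:R + k%:R + 7)); last first.
  by rewrite !(natrD, natrM) -[k.+1%:R]natr1; ring.
by rewrite !mulf_eq0 /= natr1 -natrM -!natrD !pnatr_eq0; lia.
Qed.

(** * Effectiveness of the series for at most three coordinates *)

Lemma lattice_char0 (R : realType) (k t : nat) (e := nat_of_bool (odd (t * k))) :
  lattice_char R t (block_cycle k.+1 0) = (1 - e)%N.
Proof.
rewrite (@lattice_char_slices R k 0 t (fun=> [:: 0])); first by rewrite sum1_card card_ord.
move=> j; rewrite -/e => je; have [-> ->] : j = 0%N /\ e = 0%N by lia.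
split=> // w; rewrite inE thinmx0 eqxx big_ord0; split=> // _.
split; first by rewrite !muln0 mulr0.
move=> S; have -> : #|S| = 0%N by apply: eq_card0 => -[].
by rewrite big1 ?muln0 ?mul0n // => -[].
Qed.

Lemma lattice_char1 (R : realType) (k t : nat) (e := nat_of_bool (odd (t * k))) :
  ~~ odd (k.+1 * e) -> lattice_char R t (block_cycle k.+1 1) = (t.+1 - e)%N.
Proof.
move=> ke.
have h2 : (2 * (k.+1 * e)./2 = k.+1 * e)%N.
  by have := odd_double_half (k.+1 * e); rewrite (negPf ke) -mul2n add0n => ->.
have e1 : (e <= 1)%N by rewrite /e; case: odd.
pose W j : seq 'rV[int]_1 := [:: const_mx (t + k.+1 * j + (k.+1 * e)./2)%N%:Z].
rewrite (@lattice_char_slices R k 1 t W); first by rewrite mul1n sum1_card card_ord.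
move=> j; rewrite mul1n -/e => je; split=> // w.
have -> : w = const_mx (w 0 0) by apply/rowP => i; rewrite !mxE ord1.
move: (w 0 0) => b; rewrite big_ord1 mxE inE; split.
  move=> /eqP /rowP /(_ 0); rewrite !mxE => ->.
  clearbody e; move: (_./2) h2 => h h2.
  have it : (k.+1 * (j + e) <= k.+1 * t)%N by rewrite leq_mul2l; lia.
  rewrite mulnDr in it.
  split; first by nia.
  move=> S; have [->|S0] := eqVneq S finset.set0.
    by rewrite cards0 big_set0 muln0.
  have -> : S = [set 0]%SET.
    apply/setP => x; rewrite inE ord1 eqxx.
    by case/set0Pn: S0 => y; rewrite ord1.
  rewrite cards1 big_set1 mxE.
  have -> : (1 * (2 * (k.+1 + 1) + 1 - 1) = 2 * k + 4)%N by lia.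
  by rewrite mulnDr mulnCA; lia.
move=> [tot _]; apply/eqP/rowP => i; rewrite !mxE.
by clearbody e; move: (_./2) h2 => h h2; nia.
Qed.

Lemma block_cycle_val (k m : nat) (i : 'I_(k + m)) :
  block_cycle k m i = (if i < k then i.+1 %% k else i)%N :> nat.
Proof.
by case: (split_ordP i) => j ->; rewrite ?block_cycle_l ?block_cycle_r.
Qed.

Lemma forall_ord3 (P : 'I_3 -> Prop) :
  P ord0 -> P (lift ord0 ord0) -> P (lift ord0 (lift ord0 ord0)) -> forall i, P i.
Proof.
move=> P0 P1 P2 i; case: (unliftP ord0 i) => [j ->|->] //.
case: (unliftP ord0 j) => [l ->|->] //.
by rewrite [l]ord1.
Qed.

Lemma block_cycle21E (o0 : 'I_3 := ord0) (o1 : 'I_3 := lift ord0 ord0)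
    (o2 : 'I_3 := lift ord0 (lift ord0 ord0)) :
  [/\ block_cycle 2 1 o0 = o1, block_cycle 2 1 o1 = o0
    & block_cycle 2 1 o2 = o2].
Proof. by split; apply: val_inj; rewrite /= block_cycle_val. Qed.

Lemma block_cycle30E (o0 : 'I_3 := ord0) (o1 : 'I_3 := lift ord0 ord0)
    (o2 : 'I_3 := lift ord0 (lift ord0 ord0)) :
  [/\ block_cycle 3 0 o0 = o1, block_cycle 3 0 o1 = o2
    & block_cycle 3 0 o2 = o0].
Proof. by split; apply: val_inj; rewrite /= block_cycle_val. Qed.

Lemma S3_conj (g : 'S_3) : exists x : 'S_3,
  [\/ g = (block_cycle 1 2 ^ x)%g, g = (block_cycle 2 1 ^ x)%g
    | g = (block_cycle 3 0 ^ x)%g].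
Proof.
have gP (h : 'S_3) : (forall i, h i = g i) -> g = h.
  by move=> e; apply/permP => i; rewrite e.
pose o0 : 'I_3 := ord0; pose o1 : 'I_3 := lift ord0 ord0.
pose o2 : 'I_3 := lift ord0 (lift ord0 ord0).
have := perm_inj (s := g) (x1 := o0) (x2 := o1).
have := perm_inj (s := g) (x1 := o0) (x2 := o2).
have := perm_inj (s := g) (x1 := o1) (x2 := o2).
move g0E : (g o0) => g0; move g1E : (g o1) => g1; move g2E : (g o2) => g2.
have red (h : 'S_3) : h o0 = g0 -> h o1 = g1 -> h o2 = g2 -> g = h.
  by move=> h0 h1 h2; apply: gP; apply: forall_ord3; rewrite -/o0 -/o1 -/o2 ?h0 ?h1 ?h2.
move: red; clear g0E g1E g2E gP.
have ev (s : 'S_3) (a b i j p q : 'I_3) :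
    s p = q -> tperm a b i = p -> tperm a b q = j -> (s ^ tperm a b)%g i = j.
  by move=> spq ip <-; rewrite conjgE !permM tpermV ip spq.
have [b0 b1 b2] := block_cycle21E.
have [c0 c1 c2] := block_cycle30E.
elim/forall_ord3: g0; elim/forall_ord3: g1; elim/forall_ord3: g2 => red n12 n02 n01;
  try by (have := n12 erefl; have := n02 erefl; have := n01 erefl).
all: try by have := n12 erefl.
all: try by have := n02 erefl.
all: try by have := n01 erefl.
- exists 1%g; apply: Or31; rewrite conjg1 block_cycle1.
  by apply: red; rewrite perm1.
- exists (tperm o0 o2); apply: Or32; apply: red.
  + by apply: (ev _ _ _ _ _ _ _ b2); rewrite permE.
  + by apply: (ev _ _ _ _ _ _ _ b1); rewrite permE.
  + by apply: (ev _ _ _ _ _ _ _ b0); rewrite permE.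
- by exists 1%g; apply: Or32; rewrite conjg1; apply: red.
- by exists 1%g; apply: Or33; rewrite conjg1; apply: red.
- exists (tperm o0 o1); apply: Or33; apply: red.
  + by apply: (ev _ _ _ _ _ _ _ c1); rewrite permE.
  + by apply: (ev _ _ _ _ _ _ _ c0); rewrite permE.
  + by apply: (ev _ _ _ _ _ _ _ c2); rewrite permE.
- exists (tperm o1 o2); apply: Or32; apply: red.
  + by apply: (ev _ _ _ _ _ _ _ b0); rewrite permE.
  + by apply: (ev _ _ _ _ _ _ _ b2); rewrite permE.
  + by apply: (ev _ _ _ _ _ _ _ b1); rewrite permE.
Qed.

Lemma S2_cases (g : 'S_2) : g = block_cycle 1 1 \/ g = block_cycle 2 0.
Proof.
have inj := perm_inj (s := g) (x1 := ord0) (x2 := lift ord0 ord0).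
have ordP (i : 'I_2) : i = ord0 \/ i = lift ord0 ord0.
  case: (unliftP ord0 i) => [j ->|->]; last by left.
  by right; rewrite [j]ord1.
have [g0|g0] := ordP (g ord0); have [g1|g1] := ordP (g (lift ord0 ord0)).
- by have := inj (etrans g0 (esym g1)).
- left; apply/permP => i; rewrite block_cycle1 perm1.
  by have [->|->] := ordP i.
- right; apply/permP => i; apply: val_inj; have /= -> := @block_cycle_val 2 0 i.
  by have [->|->] := ordP i; rewrite ?g0 ?g1.
- by have := inj (etrans g0 (esym g1)).
Qed.

Lemma effective_trivial (R : realType) (n : nat) :
  (forall i (g : 'S_n), Hstar_coef R i g = if i == 0%N then 1 else 0) -> Hstar_effective R n.
Proof.
move=> H i.
have -> : Hstar R n i = (i == 0%N)%:R.
  apply/cfunP => g; rewrite HstarE H.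
  by case: eqP => _; rewrite ?cfun1E ?inE ?rmorph1 // cfunE rmorph0.
by case: eqP => _; [exact: cfun1_char | exact: cfun0_char].
Qed.

Lemma effective_1 (R : realType) : Hstar_effective R 1.
Proof.
apply: effective_trivial => i g.
have -> : g = block_cycle 1 0 by apply/permP => j; rewrite !ord1.
rewrite (Hstar_coef_block_cycle R 0 0) /= /lag_diff !lattice_char0 !muln0 /= subn0.
by case: i => [|i] /=; rewrite ?subr0 ?subrr.
Qed.

Lemma effective_2 (R : realType) : Hstar_effective R 2.
Proof.
apply: effective_trivial => i g; have [->|->] := S2_cases g.
  rewrite (Hstar_coef_block_cycle R 0 1) /=; set u := fun t => _.
  have uE t : u t = t%:R + 1 by rewrite /u lattice_char1 muln0 //= subn0 natr1.
  case: i => [|[|i]].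
  - by rewrite /lag_diff /= uE !subr0 add0r.
  - by rewrite /lag_diff /= ?(subSS, subnn, subn0) !uE /=; ring.
  - by rewrite !lag_diff1S !uE -!natr1 /=; ring.
rewrite (Hstar_coef_block_cycle R 1 0) /=; set u := fun t => _.
have uE t : u t = if odd t then 0 else 1.
  by rewrite /u lattice_char0 muln1; case: odd.
case: i => [|[|i]].
- by rewrite /lag_diff /= uE !subr0.
- by rewrite /lag_diff /= ?(subSS, subnn, subn0) !uE /=; ring.
- by rewrite -[i.+2]addn2 lag_diffD !uE addn2 /= negbK subrr.
Qed.

Lemma Hstar_coef_3 (R : realType) (i : nat) :
  [/\ Hstar_coef R i (block_cycle 1 2) = [:: 1; 4; 1]`_i,
      Hstar_coef R i (block_cycle 2 1) = [:: 1; 0; 1]`_i &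
      Hstar_coef R i (block_cycle 3 0) = [:: 1; 1; 1]`_i].
Proof.
split.
- rewrite (Hstar_coef_block_cycle R 0 2) /=; set u := fun t => _.
  have uE t : u t = 3 * t%:R ^+ 2 + 3 * t%:R + 1.
    by rewrite /u lattice_char2E muln0 //=; ring.
  case: i => [|[|[|i]]].
  + by rewrite /lag_diff /= uE /=; ring.
  + by rewrite /lag_diff /= ?(subSS, subnn, subn0) !uE /=; ring.
  + by rewrite /lag_diff /= ?(subSS, subnn, subn0) !uE /=; ring.
  + by rewrite !lag_diff1S !uE -!natr1 /= nth_nil; ring.
- rewrite (Hstar_coef_block_cycle R 1 1) /=; set u := fun t => _.
  have uE t : u t = if odd t then t%:R else t%:R + 1.
    rewrite /u lattice_char1 ?muln1 ?mul2n ?odd_double //.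
    by case: odd; rewrite ?subn1 ?subn0 ?natr1.
  case: i => [|[|[|i]]].
  + by rewrite /lag_diff /= uE /=; ring.
  + by rewrite /lag_diff /= ?(subSS, subnn, subn0) !uE /=; ring.
  + by rewrite /lag_diff /= ?(subSS, subnn, subn0) !uE /=; ring.
  + rewrite lag_diff1S -[i.+3]addn2 -[i.+2]addn2 !lag_diffD !uE !addn2 /= !negbK nth_nil.
    by case: odd => /=; rewrite -!natr1; ring.
- rewrite (Hstar_coef_block_cycle R 2 0) /=; set u := fun t => _.
  have uE t : u t = 1 by rewrite /u lattice_char0 muln2 odd_double.
  case: i => [|[|[|i]]].
  + by rewrite /lag_diff /= uE /=; ring.
  + by rewrite /lag_diff /= ?(subSS, subnn, subn0) !uE /=; ring.
  + by rewrite /lag_diff /= ?(subSS, subnn, subn0) !uE /=; ring.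
  + by rewrite -[i.+3]addn3 lag_diffD !uE addn3 /= nth_nil subrr.
Qed.

Fact sign_repr_subproof (n : nat) :
  mx_repr [set: 'S_n]%G (fun s : 'S_n => ((-1) ^+ s)%:M : 'M[algC]_1).
Proof.
split=> [|s t _ _]; first by rewrite odd_perm1.
by rewrite odd_permM signr_addb scalar_mxM.
Qed.

Fact perm_repr_subproof (n : nat) :
  mx_repr [set: 'S_n]%G (@perm_mx algC n).
Proof. by split=> [|s t _ _]; rewrite ?perm_mx1 ?perm_mxM. Qed.

Lemma perm_mx_trace (n : nat) (s : 'S_n) :
  \tr (perm_mx s : 'M[algC]_n) = (\sum_i (s i == i))%:R.
Proof. by rewrite natr_sum; apply: eq_bigr => i _; rewrite !mxE. Qed.

Lemma odd_block_cycle21 : odd_perm (block_cycle 2 1) = true.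
Proof.
have -> : block_cycle 2 1 = tperm ord0 (lift ord0 ord0).
  have [b0 b1 b2] := block_cycle21E.
  by apply/permP; apply: forall_ord3; rewrite ?(b0, b1, b2) permE.
by rewrite odd_tperm.
Qed.

Lemma odd_block_cycle30 : odd_perm (block_cycle 3 0) = false.
Proof.
have : (block_cycle 3 0 * block_cycle 3 0 * block_cycle 3 0 = 1)%g.
  have [c0 c1 c2] := block_cycle30E.
  by apply/permP; apply: forall_ord3; rewrite !permM perm1 !(c0, c1, c2).
move=> /(congr1 (@odd_perm _)); rewrite !odd_permM odd_perm1.
by case: odd_perm.
Qed.

(** The computation gives [H*(z) = 1 + (sgn + nat_perm) z + z^2], where [sgn] is
the sign and [nat_perm] is the permutation character on three points. *)
Lemma effective_3 (R : realType) : Hstar_effective R 3.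
Proof.
pose sgn := cfRepr (MxRepresentation (sign_repr_subproof 3)).
pose nat_perm := cfRepr (MxRepresentation (perm_repr_subproof 3)).
have class_ext (phi psi : 'CF([set: 'S_3]%G)) :
    phi (block_cycle 1 2) = psi (block_cycle 1 2) ->
    phi (block_cycle 2 1) = psi (block_cycle 2 1) ->
    phi (block_cycle 3 0) = psi (block_cycle 3 0) -> phi = psi.
  move=> e1 e2 e3; apply/cfunP => g; have [x [->|->|->]] := S3_conj g;
    by rewrite !cfunJ ?inE.
move=> i; have [c1 c2 c3] := Hstar_coef_3 R i.
case: i c1 c2 c3 => [|[|[|i]]] c1 c2 c3.
- have -> : Hstar R 3 0 = 1 by apply: class_ext; rewrite HstarE ?c1 ?c2 ?c3 cfun1E inE /= rmorph1.
  exact: cfun1_char.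
- have -> : Hstar R 3 1 = sgn + nat_perm.
    apply: class_ext; rewrite HstarE ?c1 ?c2 ?c3 !cfunE !inE /=.
    + rewrite perm_mx_trace mxtrace_scalar block_cycle1 odd_perm1 expr0 /= rmorph_nat.
      by rewrite (eq_bigr (fun=> 1%N)) ?sum1_card ?card_ord -?natrD // => j _; rewrite perm1 eqxx.
    + rewrite perm_mx_trace mxtrace_scalar odd_block_cycle21 expr1 rmorph0.
      have [b0 b1 b2] := block_cycle21E.
      rewrite !big_ord_recl big_ord0 b0 b1 b2 -!val_eqE /=.
      by rewrite !mulr1n addNr.
    + rewrite perm_mx_trace mxtrace_scalar odd_block_cycle30 expr0 rmorph1.
      have [b0 b1 b2] := block_cycle30E.
      rewrite !big_ord_recl big_ord0 b0 b1 b2 -!val_eqE /=.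
      by rewrite !mulr1n addr0.
  by rewrite rpredD ?cfRepr_char.
- have -> : Hstar R 3 2 = 1 by apply: class_ext; rewrite HstarE ?c1 ?c2 ?c3 cfun1E inE /= rmorph1.
  exact: cfun1_char.
- have -> : Hstar R 3 i.+3 = 0 by apply: class_ext; rewrite HstarE ?c1 ?c2 ?c3 cfunE /= nth_nil rmorph0.
  exact: cfun0_char.
Qed.

(** * A singular face *)

Lemma dilate1 (R : realType) (n : nat) (P : set 'rV[R]_n) : dilate 1 P = P.
Proof.
apply/seteqP; split=> [_ [y Py <-]|y Py]; first by rewrite scale1r.
by exists y => //; rewrite scale1r.
Qed.

Lemma lattice_permutahedronP (R : realType) (n : nat) (v : 'rV[int]_n) :
  lattice_points (@permutahedron R n) v <->
  2 * \sum_i v 0 i = (n * n.+1)%:Z /\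
  forall S : {set 'I_n}, (#|S| * #|S|.+1)%:Z <= 2 * \sum_(i in S) v 0 i.
Proof.
rewrite -{1}[permutahedron (n:=n)]dilate1 lattice_dilateP mul1n.
by split=> -[tot dom]; split=> // S; have := dom S; rewrite mul1n.
Qed.

Lemma lattice_coord1 (R : realType) (n : nat) (v : 'rV[int]_n) (i : 'I_n) :
  lattice_points (@permutahedron R n) v -> 1 <= v 0 i <= n%:Z.
Proof.
move=> Lv; have := @lattice_coord_bound R n 1 v i.
by rewrite dilate1 muln1; apply.
Qed.

Lemma lattice_points_finite (R : realType) (n : nat) (F : set 'rV[R]_n) :
  F `<=` @permutahedron R n -> finite_set (lattice_points F).
Proof.
move=> FP; pose h (f : {ffun 'I_n -> 'I_n.+1}) : 'rV[int]_n := \row_i (f i : nat)%:Z.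
apply: (@sub_finite_set _ _ (h @` setT)); last exact/finite_image/finite_finset.
move=> v Lv; have Pv : lattice_points (@permutahedron R n) v by apply: FP.
exists [ffun i => inord (absz (v 0 i))] => //.
apply/rowP => i; rewrite !mxE ffunE.
by have := lattice_coord1 i Pv => b; rewrite inordK; lia.
Qed.

Lemma derive_line0 (R : realType) (n : nat) (f : 'rV[R[i]^o]_n -> R[i]^o)
    (x d : 'rV[R[i]^o]_n) :
  (forall h : R[i], f (x + h *: d) = 0) -> 'D_d f x = 0.
Proof.
move=> f0; rewrite /derive.
have -> : (fun h : R[i] => h^-1 *: ((f \o shift x) (h *: d) - f x)) = cst 0.
  apply/funext => h /=; rewrite [_ + x]addrC f0.
  by have := f0 0; rewrite scale0r addr0 => ->; rewrite subr0 scaler0.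
exact: lim_cst.
Qed.

Lemma exprz_opp_swap (K : fieldType) (z : K) (m l : nat) :
  odd (m + l) -> z ^ l * (- z) ^ m = - (z ^ m * (- z) ^ l).
Proof.
rewrite -!exprnP !(exprNn z) oddD => ml.
rewrite -signr_odd -[in RHS]signr_odd.
by case: (odd m) (odd l) ml => -[] //= _; rewrite ?expr0 ?expr1; ring.
Qed.

(** Exchanging the exponents at [p] and [q], whose difference is odd, pairs off the
monomials of an invariant polynomial; on [y_p + y_q = 0] the two monomials
of a pair cancel. *)
Lemma hypersurface_antisym (R : realType) (n : nat) (F : set 'rV[R]_n)
    (a : 'rV[int]_n -> R[i]^o) (p q : 'I_n) (y : 'rV[R[i]^o]_n) :
  F `<=` @permutahedron R n -> invariant_coefs (@permutahedron R n) a ->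
  p != q ->
  (forall v, lattice_points F v -> lattice_points F (col_perm (tperm p q) v)) ->
  (forall v, lattice_points F v -> exists k : int, v 0 p + v 0 q = 2 * k + 1) ->
  y 0 p + y 0 q = 0 -> hypersurface F a y = 0.
Proof.
move=> FP ainv pq Fsym odd_pq ypq.
pose g v := a v * \prod_(i < n) y 0 i ^ v 0 i.
pose s := col_perm (tperm p q) : 'rV[int]_n -> _.
have sK : involutive s by move=> v; apply/rowP => i; rewrite !mxE tpermK.
have FPl v : lattice_points F v -> lattice_points (@permutahedron R n) v := FP _.
have gs v : lattice_points F v -> g (s v) = - g v.
  move=> Lv; rewrite /g.
  have -> : a (s v) = a v.
    apply: (ainv _ _ (FPl _ (Fsym _ Lv)) (FPl _ Lv)).
    by exists (tperm p q); rewrite -[RHS]/(s (s v)) sK.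
  rewrite -mulrN; congr (_ * _).
  rewrite (bigD1 p) //= (bigD1 q) 1?eq_sym //= [in RHS](bigD1 p) //= [in RHS](bigD1 q) 1?eq_sym //=.
  rewrite !mxE tpermL tpermR.
  set c1 := \prod_(i < n | _) _; set c2 := \prod_(i < n | _) _.
  have -> : c1 = c2.
    apply: eq_bigr => i /andP[ip iq]; rewrite mxE tpermD // eq_sym //.
  rewrite !mulrA -mulNr; congr (_ * c2).
  have /andP[+ _] := lattice_coord1 p (FPl _ Lv).
  have /andP[+ _] := lattice_coord1 q (FPl _ Lv).
  have [k] := odd_pq v Lv.
  case: (v 0 p) => // m; case: (v 0 q) => // l mlk _ _.
  have -> : y 0 q = - y 0 p by apply/eqP; rewrite -addr_eq0 addrC ypq.
  by apply: exprz_opp_swap; lia.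
have sbij : set_bij (lattice_points F) (lattice_points F) s.
  split=> [v Lv|v w _ _ /(inv_inj sK)//|v Lv]; first exact: Fsym.
  by exists (s v); [exact: Fsym | exact: sK].
have sumE : hypersurface F a y = - hypersurface F a y.
  rewrite {1}/hypersurface (reindex_fsbig s _ _ _ sbij).
  rewrite (@eq_fsbigr _ _ _ _ _ (fun v => - g v)); last first.
    by move=> v /set_mem /gs.
  rewrite /hypersurface !fsbig_finite; [|exact: lattice_points_finite..].
  exact: sumrN.
have /eqP : hypersurface F a y *+ 2 = 0 by rewrite mulr2n {1}sumE addNr.
by rewrite mulrn_eq0 => /eqP.
Qed.

(** The face where [x_1 + x_2] and [x_1 + x_2 + x_3 + x_4] are minimal gives a
polynomial that vanishes on [x_1 + x_2 = 0] and on [x_3 + x_4 = 0]. Moving a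
single coordinate from the point [(1, -1, 1, -1, 1, ..., 1)] stays in one of
these two, so that all partial derivatives are [0] there. *)
Lemma no_invariant_nondegenerate (R : realType) (m : nat) :
  ~ has_invariant_nondegenerate R m.+4.
Proof.
move=> [a [ainv [_ nondeg]]].
pose P := @permutahedron R m.+4.
pose i0 : 'I_m.+4 := inord 0; pose i1 : 'I_m.+4 := inord 1.
pose i2 : 'I_m.+4 := inord 2; pose i3 : 'I_m.+4 := inord 3.
have iE (j k : nat) : (j < 4)%N -> (k < 4)%N -> (inord j == inord k :> 'I_m.+4) = (j == k).
  by move=> j4 k4; rewrite -val_eqE /= !inordK //; lia.
pose S2 := (i0 |: [set i1])%SET; pose S4 := (i0 |: (i1 |: (i2 |: [set i3])))%SET.
have sumS (x : 'rV[R]_m.+4) : [/\ #|S2| = 2%N, #|S4| = 4%N,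
   \sum_(i in S2) x 0 i = x 0 i0 + x 0 i1 &
   \sum_(i in S4) x 0 i = x 0 i0 + (x 0 i1 + (x 0 i2 + x 0 i3))].
  by split; rewrite ?cardsU1 ?cards1 ?big_setU1 ?big_set1 ?inE ?iE.
pose c : 'cV[R]_m.+4 := - (delta_mx i0 0 + delta_mx i1 0) -
  (delta_mx i0 0 + delta_mx i1 0 + delta_mx i2 0 + delta_mx i3 0).
have cE (x : 'rV[R]_m.+4) : (x *m c) 0 0 =
    - (x 0 i0 + x 0 i1) - (x 0 i0 + x 0 i1 + x 0 i2 + x 0 i3).
  by rewrite /c !(mulmxDr, mulmxN) -!colE !mxE.
have Pge (x : 'rV[R]_m.+4) : P x ->
    3 <= x 0 i0 + x 0 i1 /\ 10 <= x 0 i0 + x 0 i1 + x 0 i2 + x 0 i3.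
  move=> Px; have [c2 c4 s2 s4] := sumS x.
  have := permutahedron_ge S2 Px; rewrite s2 c2.
  by have := permutahedron_ge S4 Px; rewrite s4 c4; lra.
pose F := [set x | P x /\ (x *m c) 0 0 = - 13].
have Fface : is_face P F.
  by exists c, (-13); split=> // x /Pge [h1 h2]; rewrite cE; lra.
have FE x : F x <-> [/\ P x, x 0 i0 + x 0 i1 = 3 & x 0 i2 + x 0 i3 = 7].
  split=> [[Px]|[Px h1 h2]]; last by split=> //; rewrite cE; lra.
  by have [h1 h2] := Pge _ Px; rewrite cE => h; split=> //; lra.
have Fn0 : F !=set0.
  exists (\row_j (j.+1)%:R); apply/FE; split.
  - have := @permutahedron_vertex R m.+4 1%g; congr permutahedron.
    by apply/rowP => j; rewrite !mxE perm1.
  - by rewrite !mxE !inordK // -natrD.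
  - by rewrite !mxE !inordK // -natrD.
have FP : F `<=` P by move=> x [].
have Fint v : lattice_points F v -> v 0 i0 + v 0 i1 = 3 /\ v 0 i2 + v 0 i3 = 7.
  move=> /FE [_]; rewrite !mxE -!intrD => h1 h2.
  by split; apply/eqP; rewrite -(eqr_int R) ?h1 ?h2.
have neq_i (j k : nat) : (j < 4)%N -> (k < 4)%N -> (j != k)%N -> inord j != inord k :> 'I_m.+4.
  by move=> j4 k4; rewrite iE.
have Fsym (p q : 'I_m.+4) v :
    (p = i0 /\ q = i1) \/ (p = i2 /\ q = i3) ->
    lattice_points F v -> lattice_points F (col_perm (tperm p q) v).
  move=> pq /FE [Pv h1 h2]; apply/FE.
  rewrite map_col_perm; split; first exact: permutahedron_perm.
    rewrite !mxE in h1 *; case: pq => -[-> ->].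
      by rewrite tpermL tpermR addrC.
    by rewrite !tpermD ?neq_i.
  rewrite !mxE in h2 *; case: pq => -[-> ->].
    by rewrite !tpermD ?neq_i.
  by rewrite tpermL tpermR addrC.
pose x : 'rV[R[i]^o]_m.+4 := \row_i (if (i == i1) || (i == i3) then -1 else 1).
have x0 i : x 0 i != 0 by rewrite mxE; case: ifP; rewrite ?oppr_eq0 oner_neq0.
have [i /eqP] := nondeg F Fface Fn0 x x0; apply.
apply: derive_line0 => h.
have [xi0 xi1 xi2 xi3] : [/\ x 0 i0 = 1, x 0 i1 = -1, x 0 i2 = 1 & x 0 i3 = -1].
  by split; rewrite mxE !iE.
have yE j : j != i -> (x + h *: delta_mx 0 i) 0 j = x 0 j.
  by move=> /negPf ji; rewrite [LHS]mxE [X in _ + X]mxE [X in _ * X]mxE ji andbF mulr0 addr0.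
have [i01|i01] := boolP (i \in [:: i0; i1]).
  have [n2 n3] : i2 != i /\ i3 != i.
    by move: i01; rewrite !inE => /orP[] /eqP ->; rewrite !neq_i.
  apply: (@hypersurface_antisym R _ F a i2 i3) => //; rewrite ?neq_i //.
  - by move=> v; apply: Fsym; right.
  - by move=> v /Fint [_ ->]; exists 3.
  - by rewrite !yE // xi2 xi3 subrr.
have [n0 n1] : i0 != i /\ i1 != i.
  by move: i01; rewrite !inE negb_or ![i == _]eq_sym => /andP.
apply: (@hypersurface_antisym R _ F a i0 i1) => //; rewrite ?neq_i //.
- by move=> v; apply: Fsym; left.
- by move=> v /Fint [-> _]; exists 1.
- by rewrite !yE // xi0 xi1 subrr.
Qed.

(** * Critical points of hypersurfaces *)

Lemma horner_cvg (K : numFieldType) (p : {poly K}) (x : K) :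
  horner p @ x --> p.[x].
Proof.
elim/poly_ind: p => [|p c IH].
  have -> : horner (0 : {poly K}) = cst 0 by apply/funext => y; rewrite horner0.
  exact: (@cvg_cst K 0 K (nbhs x) _).
have -> : horner (p * 'X + c%:P) = (fun y => p.[y] * y + c).
  by apply/funext => y; rewrite hornerMXaddC.
have cX : (fun y : K => y) @ x --> x by exact: cvg_id.
have cpX : (fun y : K => p.[y] * y) @ x --> (p.[x] * x : K) by exact: (cvgM IH cX).
exact: (@cvgD K K K (nbhs x) _ _ (cst c) _ _ cpX (@cvg_cst K c K (nbhs x) _)).
Qed.

(** The difference quotient is a polynomial in the increment, hence continuous. *)
Lemma derive_poly_line (K : numFieldType) (V : normedModType K) (f : V -> K^o)
    (a d : V) (p : {poly K}) :
  (forall h : K, f (a + h *: d) = p.[h]) -> 'D_d f a = p^`().[0].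
Proof.
move=> fp.
have /factor_theorem [q qE] : root (p - p.[0]%:P) 0.
  by rewrite rootE !hornerE subrr.
have {}qE : p = q * 'X + p.[0]%:P.
  by move: qE; rewrite polyC0 subr0 => <-; rewrite subrK.
have -> : p^`().[0] = q.[0].
  by rewrite qE derivD derivM derivX derivC !hornerE.
have f0 : f a = p.[0] by rewrite -fp scale0r addr0.
rewrite /derive; apply/cvg_lim => //.
have c0 : horner q @ (0 : K)^' --> q.[0].
  by apply: (@cvg_within_filter K K (horner q) (nbhs (0 : K)) _ (nbhs (q.[0] : K))); exact: horner_cvg.
move: c0; apply: cvg_trans; apply: near_eq_cvg; near=> h.
have h0 : h != 0 by near: h; exact: nbhs_dnbhs_neq.
rewrite /= [_ + a]addrC fp f0.
have -> : p.[h] - p.[0] = q.[h] * h by rewrite {1}qE hornerMXaddC addrK.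
by rewrite -[RHS]/(h^-1 * (q.[h] * h)) mulrC mulfK.
Unshelve. all: by end_near. Qed.

Lemma laurent_euler (K : numFieldType) (n : nat) (s : seq 'rV[int]_n)
    (a : 'rV[int]_n -> K) (x : 'rV[K^o]_n) (i : 'I_n) :
  (forall v, v \in s -> 0 <= v 0 i) ->
  x 0 i * 'D_(delta_mx 0 i)
      (fun y : 'rV[K^o]_n => \sum_(v <- s) a v * \prod_j y 0 j ^ v 0 j : K^o) x =
  \sum_(v <- s) (v 0 i)%:~R * (a v * \prod_j x 0 j ^ v 0 j).
Proof.
move=> s0.
pose b v : K := a v * \prod_(j | j != i) x 0 j ^ v 0 j.
pose p : {poly K} := \sum_(v <- s) (b v)%:P * ('X + (x 0 i)%:P) ^+ absz (v 0 i).
rewrite (@derive_poly_line K _ _ x _ p); last first.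
  move=> h; rewrite /p horner_sum; apply: eq_big_seq => v /s0 v0.
  rewrite !hornerE /b -mulrA; congr (_ * _).
  rewrite (bigD1 i) //= mulrC; congr (_ * _).
    apply: eq_bigr => j ji.
    by rewrite !mxE (negPf ji) andbF mulr0 addr0.
  rewrite !mxE !eqxx mulr1 addrC.
  by case: (v 0 i) v0.
rewrite /p raddf_sum /= horner_sum mulr_sumr; apply: eq_big_seq => v /s0 v0.
rewrite derivM derivC mul0r add0r deriv_exp derivD derivX derivC addr0 mul1r.
rewrite !hornerE /b [in RHS](bigD1 i) //=.
rewrite hornerMn !hornerE; move: (\prod_(j < n | _) _) => c.
case: (v 0 i) v0 => // -[|m] _ /=; first by rewrite mulr0n !(mul0r, mulr0).
by rewrite -exprnP -pmulrn exprS -mulr_natr; ring.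
Qed.

Lemma hypersurface_euler (R : realType) (n : nat) (F : set 'rV[R]_n)
    (a : 'rV[int]_n -> R[i]^o) (x : 'rV[R[i]^o]_n) (i : 'I_n) :
  F `<=` @permutahedron R n ->
  x 0 i * 'D_(delta_mx 0 i) (hypersurface F a) x =
  \sum_(v <- fset_set (lattice_points F))
    (v 0 i)%:~R * (a v * \prod_j x 0 j ^ v 0 j).
Proof.
move=> FP; have fin := lattice_points_finite FP.
have -> : hypersurface F a = (fun y => \sum_(v <- fset_set (lattice_points F))
    a v * \prod_j y 0 j ^ v 0 j).
  by apply/funext => y; rewrite /hypersurface fsbig_finite.
apply: (@laurent_euler R[i]) => v.
rewrite in_fset_set // inE => /FP Pv.
by have /andP[+ _] := @lattice_coord1 R n v i Pv; apply: le_trans.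
Qed.

(** At a singular point, the exponent vectors satisfy the linear relation whose
coefficients are the values of the monomials, which do not vanish on the
torus. *)
Lemma smooth_of_free (R : realType) (n : nat) (F : set 'rV[R]_n)
    (a : 'rV[int]_n -> R[i]^o) (T : seq 'rV[int]_n) :
  F `<=` @permutahedron R n -> uniq T ->
  (forall v, lattice_points F v -> v \in T) ->
  (exists v, lattice_points F v) -> (forall v, a v != 0) ->
  (forall w : 'rV[int]_n -> R[i],
    (forall i, \sum_(v <- T) (v 0 i)%:~R * w v = 0) -> forall v, v \in T -> w v = 0) ->
  smooth (hypersurface F a).
Proof.
move=> FP uT FT [v0 Lv0] a0 freeT x x0.
have fin := lattice_points_finite FP.
apply/existsP; apply: contraT; rewrite negb_exists => /forallP D0.
have rel i : \sum_(v <- fset_set (lattice_points F))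
    (v 0 i)%:~R * (a v * \prod_j x 0 j ^ v 0 j) = 0 :> R[i].
  by rewrite -[LHS]hypersurface_euler // (eqP (negbNE (D0 i))) mulr0.
pose w v : R[i] := if v \in fset_set (lattice_points F) then a v * \prod_j x 0 j ^ v 0 j else 0.
have : w v0 = 0.
  apply: freeT; last exact: FT.
  move=> i; rewrite -[RHS](rel i).
  transitivity (\sum_(v <- T | v \in fset_set (lattice_points F))
      (v 0 i)%:~R * (a v * \prod_j x 0 j ^ v 0 j)).
    by rewrite [RHS]big_mkcond; apply: eq_bigr => v _; rewrite /w; case: ifP; rewrite ?mulr0.
  rewrite -big_filter; apply: perm_big.
  apply: uniq_perm; rewrite ?filter_uniq ?fset_uniq // => v.
  rewrite mem_filter; apply: andb_idr; rewrite in_fset_set // inE; exact: FT.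
rewrite /w in_fset_set // mem_set // => /eqP; rewrite mulf_eq0 (negPf (a0 _)) /= => p0.
suff : \prod_j x 0 j ^ v0 0 j != 0 by rewrite p0.
by apply/prodf_neq0 => j _; apply: expfz_neq0.
Qed.

Lemma face_sub (R : realType) (n : nat) (P F : set 'rV[R]_n) : is_face P F -> F `<=` P.
Proof. by move=> [c [b [_ ->]]] x []. Qed.

(** A linear function attains its maximum over the hull at a vertex. *)
Lemma face_vertex (R : realType) (n : nat) (F : set 'rV[R]_n) :
  is_face (@permutahedron R n) F -> F !=set0 -> exists v, lattice_points F v.
Proof.
move=> [c [b [cb FE]]] [x Fx].
suff [s sF] : exists s : 'S_n, F (\row_j (s j).+1%:R).
  exists (\row_j (s j).+1%:Z); rewrite /lattice_points /=; move: sF; congr F.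
  by apply/rowP => j; rewrite !mxE.
apply: contrapT => noF; move: Fx; rewrite FE /= => -[Px xb].
suff : (x *m c) 0 0 < b by rewrite xb ltxx.
move: x Px {xb}; apply: permutahedron_sub => [x y l xb yb l0 l1|s].
  have -> : ((l *: x + (1 - l) *: y) *m c) 0 0 =
      l * (x *m c) 0 0 + (1 - l) * (y *m c) 0 0.
    by rewrite mulmxDl -!scalemxAl !mxE.
  have [->|l_neq0] := eqVneq l 0; first by lra.
  have l_gt0 : 0 < l by rewrite lt_neqAle eq_sym l_neq0.
  by nra.
rewrite lt_neqAle cb ?andbT; last exact: permutahedron_vertex.
apply/eqP => sb; apply: noF; exists s; rewrite FE; split=> //.
exact: permutahedron_vertex.
Qed.

(** * Non-degenerate hypersurfaces for at most three coordinates *)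

Lemma unit_coefs_nondegenerate (R : realType) (n : nat) :
  (forall F, is_face (@permutahedron R n) F -> F !=set0 ->
     smooth (hypersurface F (fun=> 1))) ->
  has_invariant_nondegenerate R n.
Proof.
move=> H; exists (fun=> 1); split=> //.
split=> //; apply: H; last by exists (\row_j ((1%g : 'S_n) j).+1%:R); exact: permutahedron_vertex.
exists 0, 0; split=> [x _|]; first by rewrite mulmx0 mxE.
by apply/seteqP; split=> [x Px|x []//]; split=> //; rewrite mulmx0 mxE.
Qed.

Lemma nondegenerate_1 (R : realType) : has_invariant_nondegenerate R 1.
Proof.
apply: unit_coefs_nondegenerate => F Fface F0.
apply: (@smooth_of_free _ _ _ _ [:: const_mx 1]) => //.
- exact: face_sub.
- move=> v /(face_sub Fface) Pv; rewrite inE; apply/eqP/rowP => i.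
  have b1 := @lattice_coord1 R 1 v i Pv; rewrite mxE.
  have e (z : int) : 1 <= z <= 1 -> z = 1 by lia.
  exact: e.
- exact: (face_vertex Fface F0).
- move=> w /(_ 0); rewrite big_seq1 mxE mul1r => w0 v.
  by rewrite inE => /eqP ->.
Qed.

Lemma free_edge (K : numFieldType) (u v : K) :
  2 * u + v = 0 -> u + 2 * v = 0 -> u = 0 /\ v = 0.
Proof.
move=> e1 e2.
have u3 : 3 * u = 0 by transitivity (2 * (2 * u + v) - (u + 2 * v)); [ring | rewrite e1 e2; ring].
have u0 : u = 0 by apply/eqP; move/eqP: u3; rewrite mulf_eq0 pnatr_eq0.
by split=> //; rewrite -e1 u0 mulr0 add0r.
Qed.

Lemma free_triple (K : numFieldType) (u v w : K) :
  u + v + 2 * w = 0 -> 2 * u + 3 * v + 3 * w = 0 -> 3 * u + 2 * v + w = 0 ->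
  [/\ u = 0, v = 0 & w = 0].
Proof.
move=> e1 e2 e3.
have s0 : u + v + w = 0.
  apply/eqP; rewrite -(mulrI_eq0 _ (mulfI (_ : 6 != 0 :> K))) ?pnatr_eq0 //; apply/eqP.
  transitivity ((u + v + 2 * w) + (2 * u + 3 * v + 3 * w) + (3 * u + 2 * v + w)); first by ring.
  by rewrite e1 e2 e3 !addr0.
have w0 : w = 0.
  by transitivity ((u + v + 2 * w) - (u + v + w)); [ring | rewrite e1 s0 subrr].
move: e3 s0; rewrite w0 !addr0 => e3 s0.
have u0 : u = 0.
  by transitivity ((3 * u + 2 * v) - 2 * (u + v)); [ring | rewrite e3 s0; ring].
by split=> //; move: s0; rewrite u0 add0r.
Qed.

Lemma nondegenerate_2 (R : realType) : has_invariant_nondegenerate R 2.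
Proof.
apply: unit_coefs_nondegenerate => F Fface F0.
apply: (@smooth_of_free _ _ _ _ [:: int_vec 2 [:: 1; 2]; int_vec 2 [:: 2; 1]]) => //.
- exact: face_sub.
- by rewrite /= inE andbT; apply/eqP => /rowP /(_ 0); rewrite !mxE.
- move=> v /(face_sub Fface) Pv; have [b [c vE]] := int_vec2P v.
  have := @lattice_coord1 R 2 v 0 Pv; have := @lattice_coord1 R 2 v 1 Pv.
  have /lattice_permutahedronP [] := Pv; rewrite vE !big_ord_recl big_ord0 !mxE /= => s _ cb bb.
  have [[-> ->]|[-> ->]] : (b = 1 /\ c = 2) \/ (b = 2 /\ c = 1) by lia.
    by rewrite inE eqxx.
  by rewrite !inE eqxx orbT.
- exact: (face_vertex Fface F0).
- move=> w H; have := H 0; have := H 1.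
  rewrite !big_cons !big_nil !mxE /= !mul1r !addr0 => h1 h2 v.
  have [w1 w2] := free_edge h1 h2.
  by rewrite !inE => /orP[] /eqP ->.
Qed.

Lemma lattice3P (R : realType) (v : 'rV[int]_3) :
  lattice_points (@permutahedron R 3) v <->
  (forall i, 1 <= v 0 i <= 3) /\ \sum_i v 0 i = 6.
Proof.
split=> [Pv|[b6 s6]].
  split=> [i|]; first exact: (@lattice_coord1 R 3 v i Pv).
  by have /lattice_permutahedronP [+ _] := Pv; move: (\sum_i _) => s; lia.
apply/lattice_permutahedronP; split; first by lia.
have [b [c [d vE]]] := int_vec3P v.
move: b6 s6; rewrite vE => b6.
have := b6 0; have := b6 1; have := b6 2.
rewrite !mxE !big_ord_recl big_ord0 !mxE /= => h1 h2 h3 h.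
apply/(subset_sums3 (fun n z => (n * n.+1)%:Z <= 2 * z)).
by move=> [] [] [] /=; lia.
Qed.

Lemma ord3_third (i j : 'I_3) : i != j ->
  exists k, [/\ k != i, k != j, (forall l, [|| l == i, l == j | l == k]) &
    forall (V : nmodType) (f : 'I_3 -> V), \sum_l f l = f i + (f j + f k)].
Proof.
move=> ij.
have [k /andP[ki kj]] : exists k, (k != i) && (k != j).
  apply/existsP; move: i j ij.
  by apply: forall_ord3; apply: forall_ord3 => //= _; apply/existsP;
    [exists (lift ord0 (lift ord0 ord0)) | exists (lift ord0 ord0)
    |exists (lift ord0 (lift ord0 ord0)) | exists ord0 | exists (lift ord0 ord0)|exists ord0].
have cover l : [|| l == i, l == j | l == k].
  apply: contraT; rewrite !negb_or => /and3P[li lj lk].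
  have u4 : uniq [:: i; j; k; l].
    by rewrite /= !inE !negb_or ij ![_ == l]eq_sym li lj lk [i == k]eq_sym ki [j == k]eq_sym kj.
  by have := max_card (mem [:: i; j; k; l]); rewrite (card_uniqP u4) card_ord.
exists k; split=> // V f; rewrite (bigD1 i) //= (bigD1 j) 1?eq_sym //= (bigD1 k) ?ki ?kj //=.
rewrite big_pred0 ?addr0 // => l.
by apply/negP; rewrite -!andbA => /and3P[/negPf li /negPf lj /negPf lk]; have := cover l; rewrite li lj lk.
Qed.

(** The critical equations of the hexagon, divided by monomials. The difference of
two of them splits off the difference of two of the unknowns: either these
two unknowns agree or the third one is their sum. *)
Lemma hexagon_regular (K : numFieldType) (x y z : K) : x != 0 -> y != 0 -> z != 0 ->
  y ^+ 2 + z ^+ 2 + 2 * x * y + 2 * x * z + y * z = 0 ->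
  x ^+ 2 + z ^+ 2 + 2 * x * y + 2 * y * z + x * z = 0 ->
  x ^+ 2 + y ^+ 2 + 2 * x * z + 2 * y * z + x * y = 0 -> False.
Proof.
have diff (a b c : K) : b ^+ 2 + c ^+ 2 + 2 * a * b + 2 * a * c + b * c = 0 ->
    a ^+ 2 + c ^+ 2 + 2 * a * b + 2 * b * c + a * c = 0 ->
    a = b \/ c = a + b.
  move=> ea eb; have : (b - a) * (a + b - c) = 0.
    transitivity ((b ^+ 2 + c ^+ 2 + 2 * a * b + 2 * a * c + b * c) -
      (a ^+ 2 + c ^+ 2 + 2 * a * b + 2 * b * c + a * c)); first by ring.
    by rewrite ea eb subrr.
  move=> /eqP; rewrite mulf_eq0 !subr_eq0 => /orP[] /eqP <-; by [left | right].
move=> x0 y0 z0 ex ey ez.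
have xz : x = z \/ y = x + z.
  by apply: diff; [rewrite -ex; ring | rewrite -ez; ring].
have absurd (a b : K) : b != 0 -> a = a + b -> False.
  by move=> b0 /eqP; rewrite addrC -subr_eq subrr eq_sym (negPf b0).
have [xy|zE] := diff x y z ex ey.
  rewrite -xy in ex xz; have [xz'|] := xz; last exact: absurd.
  have : 7 * x ^+ 2 = 0 by rewrite -ex -xz'; ring.
  by move/eqP; rewrite mulf_eq0 expf_eq0 (negPf x0) pnatr_eq0.
have [xz'|yE] := xz; first by apply: (absurd x y y0); rewrite -zE.
have : 2 * x = 0 by transitivity ((x + z) + (x + y) - y - z); [ring | rewrite -yE -zE; ring].
by move/eqP; rewrite mulf_eq0 (negPf x0) pnatr_eq0.
Qed.

Definition hexagon_points : seq (seq int) :=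
  [:: [:: 1; 2; 3]; [:: 1; 3; 2]; [:: 2; 1; 3]; [:: 2; 3; 1]; [:: 3; 1; 2];
      [:: 3; 2; 1]; [:: 2; 2; 2]].

Lemma hexagonP (R : realType) (v : 'rV[int]_3) :
  lattice_points (@permutahedron R 3) v <-> v \in map (int_vec 3) hexagon_points.
Proof.
rewrite lattice3P; split=> [[b6 s6]|].
  have [b [c [d vE]]] := int_vec3P v.
  have b0 := b6 ord0; have b1 := b6 (lift ord0 ord0).
  have b2 := b6 (lift ord0 (lift ord0 ord0)).
  rewrite vE !mxE /= in b0 b1 b2; rewrite vE !big_ord_recl big_ord0 !mxE /= in s6.
  rewrite vE.
  apply/mapP; exists [:: b; c; d] => //; rewrite /hexagon_points !inE !eqseq_cons !eqxx !andbT.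
  by clear -b0 b1 b2 s6; lia.
have H (b c d : int) : 1 <= b <= 3 -> 1 <= c <= 3 -> 1 <= d <= 3 -> b + (c + d) = 6 ->
    (forall i, 1 <= int_vec 3 [:: b; c; d] 0 i <= 3) /\ \sum_i int_vec 3 [:: b; c; d] 0 i = 6.
  move=> b3 c3 d3 s6; split; first by apply: forall_ord3; rewrite mxE.
  by rewrite !big_ord_recl big_ord0 !mxE /= addr0.
move=> /mapP [s]; rewrite /hexagon_points !inE => sP ->.
by move: sP; do ![case/orP] => /eqP ->; apply: H.
Qed.

(** At a critical point the logarithmic derivatives vanish. Subtracting from each
of them the value of the polynomial, which is a sixth of their sum by
homogeneity, leaves a multiple of one more variable; this gives the equations
of [hexagon_regular]. *)
Lemma hexagon_no_critical_point (K : numFieldType) (x : 'I_3 -> K) :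
  (forall i, x i != 0) ->
  (forall i, \sum_(s <- hexagon_points) (int_vec 3 s 0 i)%:~R *
     (1 * \prod_j x j ^ int_vec 3 s 0 j) = 0) ->
  False.
Proof.
move=> xn0 rel.
have := rel ord0; have := rel (lift ord0 ord0); have := rel (lift ord0 (lift ord0 ord0)).
rewrite /hexagon_points !big_cons !big_nil /= !big_ord_recl !big_ord0 !mxE /=.
have := xn0 ord0; have := xn0 (lift ord0 ord0); have := xn0 (lift ord0 (lift ord0 ord0)).
move: (x ord0) (x (lift ord0 ord0)) (x (lift ord0 (lift ord0 ord0))) => {xn0 rel x} x y z.
rewrite -!exprnP => z0 y0 x0 rz ry rx.
have cancel (c d : K) : c != 0 -> c * d = 0 -> d = 0.
  by move=> c0 /eqP; rewrite mulf_eq0 (negPf c0) => /eqP.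
apply: (@hexagon_regular K x y z x0 y0 z0).
- apply: (@cancel (x ^+ 2 * y * z)); first by rewrite !mulf_neq0 ?expf_neq0.
  move: rz ry rx; set ez := (X in X = 0); set ey := (X in _ -> X = 0 -> _).
  set ex := (X in _ -> _ -> X = 0 -> _) => rz ry rx.
  transitivity (ex - (ex + ey + ez) / 6); last by rewrite rx ry rz; field.
  by rewrite /ex /ey /ez; field.
- apply: (@cancel (x * y ^+ 2 * z)); first by rewrite !mulf_neq0 ?expf_neq0.
  move: rz ry rx; set ez := (X in X = 0); set ey := (X in _ -> X = 0 -> _).
  set ex := (X in _ -> _ -> X = 0 -> _) => rz ry rx.
  transitivity (ey - (ex + ey + ez) / 6); last by rewrite rx ry rz; field.
  by rewrite /ex /ey /ez; field.
- apply: (@cancel (x * y * z ^+ 2)); first by rewrite !mulf_neq0 ?expf_neq0.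
  move: rz ry rx; set ez := (X in X = 0); set ey := (X in _ -> X = 0 -> _).
  set ex := (X in _ -> _ -> X = 0 -> _) => rz ry rx.
  transitivity (ez - (ex + ey + ez) / 6); last by rewrite rx ry rz; field.
  by rewrite /ex /ey /ez; field.
Qed.

Lemma smooth_hexagon (R : realType) :
  smooth (hypersurface (@permutahedron R 3) (fun=> 1)).
Proof.
move=> x xn0; apply/existsP; apply: contraT; rewrite negb_exists => /forallP D0.
have inj : {in hexagon_points &, injective (int_vec 3)}.
  have s3 s : s \in hexagon_points -> exists b c d, s = [:: b; c; d].
    rewrite /hexagon_points !inE; do ![case/orP] => /eqP ->; by do 3 eexists.
  move=> s s' /s3 [b [c [d ->]]] /s3 [b' [c' [d' ->]]] /rowP e.
  have := e ord0; have := e (lift ord0 ord0); have := e (lift ord0 (lift ord0 ord0)).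
  by rewrite !mxE /= => -> -> ->.
have L_E : perm_eq (fset_set (lattice_points (@permutahedron R 3)))
    (map (int_vec 3) hexagon_points).
  apply: uniq_perm; rewrite ?fset_uniq ?(map_inj_in_uniq inj) //.
  move=> v; rewrite in_fset_set; last exact: lattice_points_finite.
  by apply/idP/idP => [/set_mem /hexagonP|/hexagonP /mem_set].
exfalso; apply: (@hexagon_no_critical_point R[i] (fun i => x 0 i)) => // i.
rewrite -(big_map (int_vec 3) xpredT (fun v => (v 0 i)%:~R * (1 * \prod_j x 0 j ^ v 0 j))).
rewrite -(perm_big _ L_E) /=.
by rewrite -[LHS]hypersurface_euler // (eqP (negbNE (D0 i))) mulr0.
Qed.

Lemma proper_face_order (R : realType) (F : set 'rV[R]_3) (c : 'cV[R]_3) (b : R)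
    (i j : 'I_3) (v : 'rV[int]_3) :
  (forall x, @permutahedron R 3 x -> (x *m c) 0 0 <= b) ->
  F = [set x | @permutahedron R 3 x /\ (x *m c) 0 0 = b] ->
  c i 0 < c j 0 -> lattice_points F v -> v 0 i < v 0 j.
Proof.
move=> cb FE cij Fv; rewrite ltNge; apply/negP => vji.
have nij : i != j by apply: contraTneq cij => ->; rewrite ltxx.
have [k [ki kj cover sumk]] := ord3_third nij.
move: Fv; rewrite FE /lattice_points /= => -[Pv vb].
have /lattice3P [b6 s6] : lattice_points (@permutahedron R 3) v by [].
(* moving one unit from the larger coordinate to the smaller one stays in the
   hexagon and increases the functional *)
pose u : 'rV[int]_3 := v + delta_mx 0 j - delta_mx 0 i.
have uE l : u 0 l = v 0 l + (l == j)%:R - (l == i)%:R by rewrite !mxE.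
have Pu : lattice_points (@permutahedron R 3) u.
  have bi := b6 i; have bj := b6 j; have bk := b6 k; move: s6; rewrite sumk => s6.
  apply/lattice3P; split; last first.
    rewrite sumk !uE !eqxx (negPf nij) (negPf ki) (negPf kj) [j == i]eq_sym (negPf nij) /=.
    by rewrite -s6; ring.
  move=> l; rewrite uE.
  have [->|lj] := eqVneq l j; first by rewrite [j == i]eq_sym (negPf nij) /=; lia.
  have [->|li] := eqVneq l i; first by rewrite /=; lia.
  by rewrite /= addr0 subr0.
have := cb _ Pu; rewrite -vb.
have -> : map_mx intr u = map_mx intr v + delta_mx 0 j - delta_mx 0 i :> 'rV[R]_3.
  by rewrite /u map_mxB map_mxD !map_delta_mx.
rewrite mulmxBl mulmxDl -!rowE; move: (_ *m c) => X; rewrite !mxE.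
by move: cij; lra.
Qed.

(** A proper face maximizes a functional with [c_i < c_j] for some [i] and [j]. Its
lattice points then satisfy [v_i < v_j]; only three of the seven points of the
hexagon do, and they are linearly independent. *)
Lemma nondegenerate_3 (R : realType) : has_invariant_nondegenerate R 3.
Proof.
apply: unit_coefs_nondegenerate => F Fface F0.
have [c [b [cb FE]]] := Fface.
have [/existsP [i /existsP [j cij]]|c_const] := boolP [exists i, [exists j, c i 0 < c j 0]].
  have nij : i != j by apply: contraTneq cij => ->; rewrite ltxx.
  have [k [ki kj cover sumk]] := ord3_third nij.
  pose T_vec p q r : 'rV[int]_3 := \row_l (if l == i then p else if l == j then q else r).
  have T_vecE p q r : [/\ T_vec p q r 0 i = p, T_vec p q r 0 j = q & T_vec p q r 0 k = r].
    by split; rewrite mxE ?eqxx // ?[j == i]eq_sym ?(negPf nij) ?(negPf ki) ?(negPf kj) ?eqxx.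
  pose T := [:: T_vec 1 2 3; T_vec 1 3 2; T_vec 2 3 1].
  apply: (@smooth_of_free _ _ _ _ T) => //.
  - exact: face_sub.
  - rewrite /T /= !inE !andbT negb_or.
    have neqT p q r p' q' r' : (p, q) != (p', q') -> T_vec p q r != T_vec p' q' r'.
      apply: contraNneq => /rowP e; have := e i; have := e j.
      have [-> -> _] := T_vecE p q r; have [-> -> _] := T_vecE p' q' r'.
      by move=> -> ->.
    by rewrite !neqT.
  - move=> v Fv; have vij := proper_face_order cb FE cij Fv.
    have /lattice3P [b6 s6] : lattice_points (@permutahedron R 3) v by apply: face_sub Fv.
    have bi := b6 i; have bj := b6 j; have bk := b6 k; move: s6; rewrite sumk => s6.
    have vE p q r : v 0 i = p -> v 0 j = q -> v 0 k = r -> v = T_vec p q r.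
      move=> e1 e2 e3; apply/rowP => l; have [t1 t2 t3] := T_vecE p q r.
      case/or3P: (cover l) => /eqP ->; first by rewrite e1 t1.
        by rewrite e2 t2.
      by rewrite e3 t3.
    rewrite /T !inE.
    have [[e1 e2 e3]|[[e1 e2 e3]|[e1 e2 e3]]] : [/\ v 0 i = 1, v 0 j = 2 & v 0 k = 3] \/
       ([/\ v 0 i = 1, v 0 j = 3 & v 0 k = 2] \/ [/\ v 0 i = 2, v 0 j = 3 & v 0 k = 1]).
      move: vij bi bj bk s6; move: (v 0 i) (v 0 j) (v 0 k); clear=> p q r vij bi bj bk s6.
      have : (p = 1 /\ q = 2 /\ r = 3) \/ (p = 1 /\ q = 3 /\ r = 2) \/
        (p = 2 /\ q = 3 /\ r = 1) by lia.
      by move=> [[-> [-> ->]]|[[-> [-> ->]]|[-> [-> ->]]]];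
        [left|right; left|right; right].
    + by rewrite (vE _ _ _ e1 e2 e3) eqxx.
    + by rewrite (vE _ _ _ e1 e2 e3) eqxx orbT.
    + by rewrite (vE _ _ _ e1 e2 e3) eqxx !orbT.
  - exact: (face_vertex Fface F0).
  - move=> w H; have := H i; have := H j; have := H k.
    rewrite /T !big_cons !big_nil.
    have [-> -> ->] := T_vecE 1 2 3; have [-> -> ->] := T_vecE 1 3 2.
    have [-> -> ->] := T_vecE 2 3 1.
    rewrite !mul1r !addr0 !addrA => e3 e2 e1 v.
    have [w1 w2 w3] := free_triple e1 e2 e3.
    by rewrite !inE => /or3P[] /eqP ->.
have cE i j : c i 0 = c j 0.
  move: c_const; rewrite negb_exists => /forallP ne.
  have := ne i; have := ne j; rewrite !negb_exists => /forallP /(_ i) + /forallP /(_ j).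
  by rewrite -!leNgt => ij ji; apply: le_anti; rewrite ij ji.
have val x : @permutahedron R 3 x -> (x *m c) 0 0 = 6 * c ord0 0.
  move=> /permutahedron_sum; rewrite mxE.
  under [X in _ -> X = _]eq_bigr => l _ do rewrite (cE l ord0).
  rewrite -mulr_suml; move: (\sum_i _) => s; rewrite natrM => s12.
  by have -> : s = 6 by lra.
have -> : F = @permutahedron R 3.
  have [x0] := F0; rewrite FE => -[Px0 x0b]; apply/seteqP; split=> [x []//|x Px].
  by split=> //; rewrite -x0b !val.
exact: smooth_hexagon.
Qed.

(** * The equivalence *)

Lemma not_polynomial (R : realType) (m : nat) : ~ Hstar_polynomial R m.+4.
Proof.
have [om|em] := boolP (odd m).
  have := @not_polynomial_3 R m om.
  by have -> : (m.+1 + 3 = m.+4)%N by lia.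
have := @not_polynomial_2 R m.+1 em.
by have -> : (m.+2 + 2 = m.+4)%N by lia.
Qed.

Theorem theorem1p3 (R : realType) (n : nat) (hn : (1 <= n)%N) :
  (has_invariant_nondegenerate R n <-> Hstar_effective R n) /\
  (Hstar_effective R n <-> Hstar_polynomial R n).
Proof.
have all_true : has_invariant_nondegenerate R n -> Hstar_effective R n ->
    (has_invariant_nondegenerate R n <-> Hstar_effective R n) /\
    (Hstar_effective R n <-> Hstar_polynomial R n).
  move=> nd eff; split; split=> // _.
  by case: n hn nd eff => // m _ _; apply: effective_polynomial.
case: n hn all_true => [|[|[|[|m]]]] // _ all_true.
- by apply: all_true; [exact: nondegenerate_1 | exact: effective_1].
- by apply: all_true; [exact: nondegenerate_2 | exact: effective_2].
- by apply: all_true; [exact: nondegenerate_3 | exact: effective_3].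
have npol := @not_polynomial R m.
have neff : ~ Hstar_effective R m.+4 by move/effective_polynomial.
by split; split=> // /no_invariant_nondegenerate.
Qed.
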